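(* Let $G=([n],E)$ be a graph with $n\ge 2$ vertices, let $G^\circ$ be the multigraph obtained by gluing vertices $1$ and $n$ of $G$, and let $M_G$ be the Tutte symmetric matrix of $G$ (both defined in the context). Then $$XB_{G^\circ}(\boldsymbol x;t)=\mathrm{trace}(M_G)=\sum_{k=1}^{n-1}(M_G)_{k,k}.$$
   Context: $[n]=\{1,\dots,n\}$, $\mathbb P=\{1,2,3,\dots\}$, $t$ is an indeterminate. A graph is $G=([n],E)$ with $n\ge 1$ and $E$ a set of 2-element subsets of $[n]$. $P_j$ is the path on $[j]$ with edges $\{i,i+1\}$. For $G=([n],E)$ and $H=([n'],E')$, the sum $G+H=([n+n'-1],E\cup\{\{i+n-1,j+n-1\}:\{i,j\}\in E'\})$ glues vertex $n$ of $G$ to vertex $1$ of $H$. For $n\ge2$, $G^\circ$ is the multigraph on vertex set $[n-1]$ whose edge multiset consists of the edges $\{i,j\}\in E$ with $1\le i<j\le n-1$, together with an edge $\{i,1\}$ for each $\{i,n\}\in E$ (as a multiset, so $G^\circ$ has exactly as many edges as $G$; an edge $\{1,n\}\in E$ becomes a loop at $1$). The Tutte symmetric function of a (multi)graph on $[n]$ is $XB_G(\boldsymbol x;t)=\sum_{\kappa:[n]\to\mathbb P}(1+t)^{e(\kappa)}x_{\kappa(1)}\cdots x_{\kappa(n)}$, where $e(\kappa)$ is the number of edges, counted with multiplicity and including loops, whose endpoints $u,v$ satisfy $\kappa(u)=\kappa(v)$. $e_n=\sum_{i_1<\cdots<i_n}x_{i_1}\cdots x_{i_n}$, $e_0=1$,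 and $e_\lambda=e_{\lambda_1}\cdots e_{\lambda_\ell}$ for a partition $\lambda$. A composition is a finite sequence $\alpha=(\alpha_1,\dots,\alpha_\ell)$ of positive integers; $\ell=\ell(\alpha)$ is its length, $\alpha_\ell$ its last part, its size is the sum of its parts; $\mathrm{sort}(\alpha)$ is the partition obtained by sorting. A component triple of $G$ is $\mathcal C=(C,\alpha,r)$ where $C$ is a connected (not necessarily induced) subgraph of $G$, $\alpha$ is a composition of size $|C|$ (number of vertices), and $1\le r\le\alpha_1$ is an integer. A subgraph triple $\mathcal S$ of $G$ is a collection of component triples $(C_1,\alpha^{(1)},r_1),\dots,(C_m,\alpha^{(m)},r_m)$ such that the disjoint union $C_1\sqcup\cdots\sqcup C_m$ is a spanning subgraph of $G$; the order of listing is immaterial. $\mathrm{ST}(G)$ is the set of subgraph triples. $\mathrm{type}(\mathcal S)=\mathrm{sort}(\alpha^{(1)}\cdots\alpha^{(m)})$ (concatenate and sort); $\mathrm{sign}(\mathcal S)=(-1)^{N-\ell(\mathrm{type}(\mathcal S))}$ with $N$ the number of vertices of the graph; $E(\mathcal S)$ is the total number of edges in $C_1,\dots,C_m$; the reduced type $\mathrm{type}'(\mathcal S)$ is $\mathrm{type}(\mathcal S)$ with one instance of $\alpha_1$ removed, where $\alpha$ is the composition of the component containing vertex $1$. For $G=([n],E)$ and $i,j\ge1$, $\mathrm{ST}^{(i)}(G+P_j)$ is the set of $\mathcal S\in\mathrm{ST}(G+P_j)$ such that, with $(C,\alpha,r)$ the component triple with $1\in C$ and $(C',\alpha',r')$ the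 component triple with $n\in C'$ (possibly the same), one has $\alpha_1=i$, $r=1$, $\{n,n+1,\dots,n+j-1\}\subseteq C'$, and the last part satisfies $\alpha'_\ell\ge j$. The Tutte symmetric matrix $M_G$ is the infinite matrix with entries $$(M_G)_{i,j}=\sum_{\mathcal S\in\mathrm{ST}^{(i)}(G+P_j)}\mathrm{sign}(\mathcal S)\,(-1)^{1-j}\,t^{E(\mathcal S)+1-j}\,e_{\mathrm{type}'(\mathcal S)},\qquad i,j\ge1.$$ For $n\ge2$ one has $(M_G)_{k,k}=0$ for all $k\ge n$, and $\mathrm{trace}(M_G)$ means $\sum_{k\ge1}(M_G)_{k,k}$, a finite sum. *)

(* Defs.v *)
From HB Require Import structures.
From mathcomp Require Import all_boot all_order all_algebra finmap multiset.
From mathcomp Require Import boolp classical_sets functions cardinality fsbigop.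

Set Implicit Arguments.
Unset Strict Implicit.
Unset Printing Implicit Defensive.

Import Order.TTheory GRing.Theory.

Local Open Scope ring_scope.
Local Open Scope mset_scope.

(* Formal power series in x_0, x_1, x_2, ... over R.  A monomial is the finite
   multiset of the indices of its variables, and a series is the family of its
   coefficients.  The variables are numbered from 0 instead of 1. *)
Definition fps (R : nzRingType) : Type := {mset nat} -> R.

HB.instance Definition _ (R : nzRingType) :=
  GRing.Lmodule.copy (fps R) ({mset nat} -> R^o).

(* The possibly infinite sum of the terms c i * x^(mon i), i : I; it is
   meaningful when every fibre of mon contains finitely many i with c i != 0.
   (\sum_(i \in A) is 0 when infinitely many terms are nonzero.) *)
Definition fps_sum (R : nzRingType) (I : choiceType) (c : I -> R)
    (mon : I -> {mset nat}) : fps R :=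
  fun m => \sum_(i \in [set i | mon i = m]%classic) c i.

Section FpsRing.
Variable R : comNzRingType.
Implicit Types (f g h : fps R) (m a b u v : {mset nat}).

Definition fps_one : fps R := fun m => (m == mset0)%:R.

Definition fps_mul f g : fps R :=
  fps_sum (fun p : {mset nat} * {mset nat} => f p.1 * g p.2)
          (fun p => p.1 `+` p.2).

Lemma submset_enum m : exists2 s : seq {mset nat}, uniq s &
  forall a, (a `<=` m)%mset -> a \in s.
Proof.
pose F (k : {ffun finsupp m -> 'I_(size m).+1}) : {mset nat} :=
  [fsfun[seq_mset_key] x : finsupp m => (k x : nat)].
exists (undup [seq F k | k : {ffun finsupp m -> 'I_(size m).+1}]).
  exact: undup_uniq.
move=> a /msubsetP am; rewrite mem_undup.
suff -> : a = F [ffun x => inord (a (val x))] by exact: map_f (mem_enum _ _).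
apply/msetP => x; rewrite /F fsfun_ffun; case: insubP => [u _ ux|].
  rewrite /= ffunE inordK ux// ltnS (leq_trans (am x))//.
  by rewrite -count_mem_mset count_size.
rewrite memNfinsupp => /eqP mx; apply/eqP; rewrite /=.
by have := am x; rewrite mx leqn0.
Qed.

Lemma msubsetDl a b m : a `+` b = m -> (a `<=` m)%mset.
Proof. by move=> <-; apply/msubsetP => x; rewrite msetE2 leq_addr. Qed.

Lemma msubsetDr a b m : a `+` b = m -> (b `<=` m)%mset.
Proof. by rewrite msetDC => /msubsetDl. Qed.

Lemma fps_mulE m (s : seq {mset nat}) f g b : uniq s ->
    (forall a, (a `<=` m)%mset -> a \in s) -> (b `<=` m)%mset ->
  fps_mul f g b =
  \sum_(u <- s) \sum_(v <- s) (if u `+` v == b then f u * g v else 0).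
Proof.
move=> us sP bm; rewrite /fps_mul /fps_sum.
rewrite (fsbigE [seq (u, v) | u <- s, v <- [seq v <- s | u `+` v == b]]).
- rewrite big_mkcond big_allpairs_dep/=; apply: eq_bigr => u _.
  rewrite big_filter big_mkcond/=; apply: eq_bigr => v _.
  by case: eqP => // uvb; rewrite mem_set.
- apply: allpairs_uniq_dep => //; first by move=> *; exact: filter_uniq.
  by move=> [? ?] [? ?] _ _ /= [-> ->].
- by move=> p /= /allpairsPdep[u [v []]] _ + ->; rewrite mem_filter => /andP[/eqP].
- move=> [u v] /= uvb; case/allpairsPdep; exists u, v.
  rewrite mem_filter uvb eqxx !sP ?(msubset_trans _ bm)//.
  + exact: msubsetDr uvb.
  + exact: msubsetDl uvb.
Qed.

Lemma sum_if_eq (s : seq {mset nat}) c (x : R) : uniq s -> c \in s ->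
  \sum_(b <- s) (if c == b then x else 0) = x.
Proof.
move=> us cs; rewrite (bigD1_seq c)//= eqxx big1 ?addr0// => b.
by rewrite eq_sym => /negPf->.
Qed.

Lemma fps_mulC : commutative fps_mul.
Proof.
move=> f g; apply/funext => m; have [s us sP] := submset_enum m; have mm := msubset_refl m.
rewrite !(fps_mulE _ _ us sP)//. rewrite exchange_big; apply: eq_bigr => u _.
by apply: eq_bigr => v _; rewrite msetDC mulrC.
Qed.

Lemma fps_mul1 : left_id fps_one fps_mul.
Proof.
move=> f; apply/funext => m; have [s us sP] := submset_enum m; have mm := msubset_refl m.
have s0 : mset0 \in s by apply: sP; apply/msubsetP => x; rewrite mset0E.
rewrite (fps_mulE _ _ us sP)// (bigD1_seq mset0)//= [X in _ + X]big1 ?addr0.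
  rewrite (bigD1_seq m) ?sP//= mset0D /fps_one !eqxx mul1r big1 ?addr0// => v.
  by rewrite mset0D => /negPf->.
move=> u /negPf u0; rewrite big1// => v _.
by rewrite /fps_one u0 mul0r if_same.
Qed.

Lemma fps_mulDl : left_distributive fps_mul +%R.
Proof.
move=> f g h; apply/funext => m; have [s us sP] := submset_enum m; have mm := msubset_refl m.
have addE (x y : fps R) b : (x + y) b = x b + y b by [].
rewrite addE !(fps_mulE _ _ us sP)// -big_split /=.
apply: eq_bigr => u _; rewrite -big_split; apply: eq_bigr => v _ /=.
by case: ifP => _; rewrite ?addr0// addE mulrDl.
Qed.

Lemma fps_mulA : associative fps_mul.
Proof.
move=> f g h; apply/funext => m; have [s us sP] := submset_enum m; have mm := msubset_refl m.
pose T u v w := if u `+` (v `+` w) == m then f u * (g v * h w) else 0.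
transitivity (\sum_(u <- s) \sum_(v <- s) \sum_(w <- s) T u v w).
  rewrite (fps_mulE _ _ us sP)//; apply: eq_bigr => u _.
  transitivity (\sum_(b <- s) \sum_(v <- s) \sum_(w <- s)
      if v `+` w == b then T u v w else 0).
    apply: eq_bigr => b _; case: ifPn => [/eqP ubm|ubm].
      rewrite (fps_mulE _ _ us sP) ?(msubsetDr ubm)// big_distrr.
      apply: eq_bigr => v _; rewrite big_distrr; apply: eq_bigr => w _ /=.
      by case: ifPn => [/eqP vwb|_]; rewrite ?mulr0// /T vwb ubm eqxx.
    rewrite big1// => v _; rewrite big1// => w _.
    by case: ifPn => // /eqP vwb; rewrite /T vwb (negPf ubm).
  rewrite exchange_big; apply: eq_bigr => v _; rewrite exchange_big.
  apply: eq_bigr => w _; rewrite /T; case: ifPn => [/eqP e|_].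
    by rewrite sum_if_eq// sP// (msubsetDr e).
  by rewrite big1// => b _; rewrite if_same.
rewrite (fps_mulE _ _ us sP)//.
transitivity (\sum_(b <- s) \sum_(w <- s) \sum_(u <- s) \sum_(v <- s)
    if u `+` v == b then T u v w else 0); last first.
  apply: eq_bigr => b _; apply: eq_bigr => w _; case: ifPn => [/eqP bwm|bwm].
    rewrite (fps_mulE _ _ us sP) ?(msubsetDl bwm)// big_distrl.
    apply: eq_bigr => u _; rewrite big_distrl; apply: eq_bigr => v _ /=.
    case: ifPn => [/eqP uvb|_]; rewrite ?mul0r//.
    by rewrite /T msetDA uvb bwm eqxx mulrA.
  rewrite big1// => u _; rewrite big1// => v _.
  by case: ifPn => // /eqP uvb; rewrite /T msetDA uvb (negPf bwm).
rewrite exchange_big [RHS]exchange_big /=.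
under eq_bigr do rewrite exchange_big.
rewrite exchange_big; apply: eq_bigr => w _.
rewrite exchange_big [RHS]exchange_big; apply: eq_bigr => u _.
rewrite [RHS]exchange_big; apply: eq_bigr => v _.
rewrite /T; case: ifPn => [/eqP e|_]; last first.
  by rewrite big1// => b _; rewrite if_same.
by rewrite sum_if_eq// sP// (@msubsetDl _ w)// -msetDA.
Qed.

Lemma fps_one_neq0 : fps_one != 0.
Proof.
apply/eqP => /(congr1 (fun f : fps R => f mset0)).
by rewrite /fps_one eqxx => /eqP; rewrite oner_eq0.
Qed.

HB.instance Definition _ := GRing.Zmodule_isComNzRing.Build (fps R)
  fps_mulA fps_mulC fps_mul1 fps_mulDl fps_one_neq0.

End FpsRing.

(* e_n, as the sum over strictly increasing n-tuples of indices *)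
Definition esym (R : comNzRingType) (n : nat) : fps R :=
  fps_sum (fun i : n.-tuple nat => (sorted ltn i)%:R)
          (fun i => seq_mset (tval i)).

Definition esym_part (R : comNzRingType) (la : seq nat) : fps R :=
  \prod_(k <- la) esym R k.

(* Vertex k of [n] = {1, ..., n} is the element of 'I_n
   of value k - 1.  In particular vertex 1 is ord0 and vertex n is ord_max. *)
Record sgraph (n : nat) := SGraph {
  edges : {set {set 'I_n}};
  edges_card2 : [forall e in edges, #|e| == 2] }.

Record mgraph (n : nat) := MGraph {
  medges : {mset {set 'I_n}};     (* loops are singletons *)
  medges_card : all (fun e : {set 'I_n} => 1 <= #|e| <= 2)%N (enum_mset medges) }.

Section PathGraph.
Variable n : nat.

Definition path_edges : {set {set 'I_n}} :=
  [set [set p.1; p.2] | p : 'I_n * 'I_n & val p.2 == (val p.1).+1].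

Lemma path_edges_card2 : [forall e in path_edges, #|e| == 2].
Proof.
apply/forall_inP => _ /imsetP[[i j] + ->]; rewrite inE /= => /eqP ji.
by rewrite cards2 -val_eqE /= ji neq_ltn ltnSn.
Qed.

Definition path_graph : sgraph n := SGraph path_edges_card2.

End PathGraph.

Section SumGraph.
Variables (n n' : nat) (G : sgraph n.+1) (H : sgraph n'.+1).

(* G has n + 1 vertices and H has n' + 1, so G + H has n + n' + 1. *)
Definition sum_embl (i : 'I_n.+1) : 'I_(n + n').+1 := inord i.
Definition sum_embr (i : 'I_n'.+1) : 'I_(n + n').+1 := inord (n + i)%N.

Definition sum_edges : {set {set 'I_(n + n').+1}} :=
  [set sum_embl @: e | e : {set _} in edges G] :|:
  [set sum_embr @: e | e : {set _} in edges H].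

Lemma sum_embl_inj : injective sum_embl.
Proof.
move=> i j /(congr1 val); rewrite /= !inordK ?ltnS; first exact: val_inj.
- by rewrite (leq_trans (leq_ord j)) ?leq_addr.
- by rewrite (leq_trans (leq_ord i)) ?leq_addr.
Qed.

Lemma sum_embr_inj : injective sum_embr.
Proof.
move=> i j /(congr1 val); rewrite /= !inordK ?ltnS ?leq_add2l ?leq_ord//.
by move=> /addnI; exact: val_inj.
Qed.

Lemma sum_edges_card2 : [forall e in sum_edges, #|e| == 2].
Proof.
apply/forall_inP => e; rewrite inE => /orP[] /imsetP[e0 e0P ->].
- by rewrite card_imset ?(forall_inP (edges_card2 G))//; exact: sum_embl_inj.
- by rewrite card_imset ?(forall_inP (edges_card2 H))//; exact: sum_embr_inj.
Qed.

Definition sum_graph : sgraph (n + n').+1 := SGraph sum_edges_card2.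

End SumGraph.

Section Glue.
Variables (n : nat) (G : sgraph n.+2).

(* the last vertex goes to the first one, the other ones stay in place *)
Definition glue_vertex (v : 'I_n.+2) : 'I_n.+1 :=
  odflt ord0 (unlift ord_max v).

Definition glue_edges : {mset {set 'I_n.+1}} :=
  seq_mset [seq glue_vertex @: e | e : {set _} <- enum (edges G)].

Lemma glue_edges_card : all (fun e : {set 'I_n.+1} => 1 <= #|e| <= 2)%N (enum_mset glue_edges).
Proof.
apply/allP => f; rewrite (perm_mem (perm_eq_seq_mset _)).
move=> /mapP[e /[!mem_enum] eG ->].
have /eqP e2 := forall_inP (edges_card2 G) _ eG.
apply/andP; split; last by rewrite (leq_trans (leq_imset_card _ _))// e2.
by rewrite card_gt0 imset_eq0 -card_gt0 e2.
Qed.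

Definition glue : mgraph n.+1 := MGraph glue_edges_card.

End Glue.

Local Notation t := ('X : {poly int}).

Definition num_mono n (G : mgraph n) (kappa : {ffun 'I_n -> nat}) : nat :=
  count (fun e : {set 'I_n} => [forall u in e, forall v in e, kappa u == kappa v])
    (enum_mset (medges G)).

Definition XB n (G : mgraph n) : fps {poly int} :=
  fps_sum (fun kappa : {ffun 'I_n -> nat} => (1 + t) ^+ num_mono G kappa)
          (fun kappa => seq_mset [seq kappa v | v <- enum 'I_n]).

Definition is_composition (k : nat) (al : seq nat) : bool :=
  all (leq 1) al && (sumn al == k).

Section SubgraphTriples.
Variables (n : nat) (G : sgraph n).

(* (vertex set of C, edge set of C, alpha, r).  The type is kept finite by
   bounding the length and the parts of alpha as well as r by n, which all
   compositions of size |C| <= n satisfy. *)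
Definition ctriple : finType :=
  ({set 'I_n} * {set {set 'I_n}} * (n.-bseq 'I_n.+1) * 'I_n.+1)%type.

Definition cverts (c : ctriple) : {set 'I_n} := c.1.1.1.
Definition cedges (c : ctriple) : {set {set 'I_n}} := c.1.1.2.
Definition calpha (c : ctriple) : seq nat := map val c.1.2.
Definition cr (c : ctriple) : nat := c.2.

Definition connected_subgraph (W : {set 'I_n}) (F : {set {set 'I_n}}) : bool :=
  [&& W != finset.set0, F \subset edges G, [forall e in F, e \subset W] &
    [forall u in W, forall v in W, connect (fun x y => [set x; y] \in F) u v]].

Definition is_ctriple (c : ctriple) : bool :=
  [&& connected_subgraph (cverts c) (cedges c),
      is_composition #|cverts c| (calpha c) &
      1 <= cr c <= head 0 (calpha c)]%N.

Implicit Types (S : {set ctriple}) (v : 'I_n).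

Definition ST : {set {set ctriple}} :=
  [set S : {set ctriple} |
    [&& [forall c in S, is_ctriple c],
        [forall c in S, forall d in S,
          (c != d) ==> [disjoint cverts c & cverts d]] &
        \bigcup_(c in S) cverts c == [set: 'I_n]]].

Definition st_type S : seq nat :=
  sort geq (flatten [seq calpha c | c <- enum S]).

Definition st_sign S : {poly int} := (-1) ^+ (n - size (st_type S)).

Definition st_edges S : nat := (\sum_(c in S) #|cedges c|)%N.

(* composition of the component containing v *)
Definition alpha_at S v : seq nat :=
  if [pick c in S | v \in cverts c] is Some c then calpha c else [::].

End SubgraphTriples.

Definition reduced_type n (S : {set ctriple n.+1}) : seq nat :=
  rem (head 0%N (alpha_at S ord0)) (st_type S).

Section TutteMatrix.
Variables (n : nat) (G : sgraph n.+1).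

(* G + P_j for j >= 1.  Vertex |G| = n + 1 of the sum has value n, and the
   vertices |G|, ..., |G| + j - 1 are those of value at least n. *)
Definition sum_path (j : nat) : sgraph (n + j.-1).+1 :=
  sum_graph G (path_graph j.-1.+1).

Definition STi (i j : nat) : {set {set ctriple (n + j.-1).+1}} :=
  [set S in ST (sum_path j) |
    [exists c in S, exists c' in S,
      [&& ord0 \in cverts c, inord n \in cverts c',
          head 0%N (calpha c) == i, cr c == 1%N,
          [set v : 'I_(n + j.-1).+1 | (n <= v)%N] \subset cverts c' &
          (j <= last 0 (calpha c'))%N]]].

(* The entries are meant for i, j >= 1.  Every S in STi i j contains the j - 1
   edges of P_j, so that the subtraction in the exponent of t is not truncated;
   (-1)^(1-j) is written (-1)^(j-1). *)
Definition tutte_matrix (i j : nat) : fps {poly int} :=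
  \sum_(S in STi i j)
     (st_sign S * (-1) ^+ j.-1 * t ^+ (st_edges S + 1 - j)%N)
       *: esym_part _ (reduced_type S).

End TutteMatrix.

(* sum of the diagonal entries of an infinite matrix with rows and columns
   indexed by 1, 2, 3, ..., finitely many of them being nonzero *)
Definition trace (M : nat -> nat -> fps {poly int}) : fps {poly int} :=
  \sum_(k \in [set k | (1 <= k)%N]%classic) M k k.

(* Main.v *)
From mathcomp Require Import boolp classical_sets fsbigop.
From mathcomp Require Import finmap multiset.
Require Import Defs.
From mathcomp Require Import all_boot all_algebra.
From mathcomp Require Import zify ring.

(* Both sides are sums over the edge sets F of G, weighted by t^|F|.  On the left,
   the colorings that are constant on the components of F, with vertices 1 and n
   identified, give the product of the power sums p_|C| over the components C, where
   those containing 1 or n are merged into a single one with one vertex fewer.  On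
   the right, the triples over an edge set of G + P_k contribute only if it contains
   the whole path, so that its components are those of an edge set F of G, with the
   path attached to the one containing n; by p_s = sum (-1)^(s - l(al)) al_1 e_al,
   the sum over the compositions factors over the components.  It remains to sum the
   factors of the components of 1 and n over k.  If 1 and n lie in the same component
   with s + 1 vertices, one is left with a composition of s and some k at most its
   last part, hence with p_s.  If they lie in components with a and b vertices, the
   sum is a convolution of complete homogeneous functions with truncated Newton
   sums, and it telescopes to p_(a + b - 1). *)

Set Implicit Arguments.
Unset Strict Implicit.
Unset Printing Implicit Defensive.

Import GRing.Theory.

Local Open Scope ring_scope.

(** * Compositions and symmetric functions *)

(** The length and the parts of a composition of [s] are at most [s], so bounded sequences over
    ['I_s.+1] miss none. *)
Definition compositions (s : nat) : seq (seq nat) :=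
  [seq al <- [seq [seq val i | i <- bseqval b] | b : s.-bseq 'I_s.+1] | is_composition s al].

Lemma composition_size s al : is_composition s al -> (size al <= s)%N.
Proof.
move=> /andP[+ /eqP <-]; elim: al => //= i al IH /andP[i0 /IH]; lia.
Qed.

Lemma composition_part s al i : is_composition s al -> i \in al -> (i <= s)%N.
Proof.
move=> /andP[_ /eqP <-]; elim: al => //= j al IH.
rewrite inE => /predU1P[->|/IH]; lia.
Qed.

Lemma composition_rcons s be i :
  is_composition s (rcons be i) =
  [&& (0 < i)%N, (i <= s)%N & is_composition (s - i) be].
Proof.
rewrite /is_composition all_rcons sumn_rcons; apply/andP/and3P => [[/andP[-> ->] /eqP <-]|].
  by rewrite leq_addl addnK eqxx.
by move=> [-> le_is /andP[-> /eqP ->]]; rewrite subnK.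
Qed.

Lemma composition_cons s be i :
  is_composition s (i :: be) =
  [&& (0 < i)%N, (i <= s)%N & is_composition (s - i) be].
Proof.
rewrite -composition_rcons /is_composition all_rcons sumn_rcons /=.
by rewrite addnC.
Qed.

Lemma composition0 be : is_composition 0 be = (be == [::]).
Proof.
case: be => [//|i be]; rewrite composition_cons.
by case: i.
Qed.

Lemma composition_bseqP n s al : (s <= n)%N -> is_composition s al ->
  exists b : n.-bseq 'I_n.+1, [seq val i | i <- bseqval b] = al.
Proof.
move=> le_sn cal.
have sz : (size [seq inord i : 'I_n.+1 | i <- al] <= n)%N.
  by rewrite size_map (leq_trans (composition_size cal)).
exists (Bseq sz); rewrite /= -map_comp -[RHS]map_id; apply/eq_in_map => i ial /=.
by rewrite inordK// ltnS (leq_trans (composition_part cal ial)).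
Qed.

Lemma mem_compositions s al : (al \in compositions s) = is_composition s al.
Proof.
rewrite mem_filter andb_idr// => cal.
by have [b <-] := composition_bseqP (leqnn s) cal; apply: map_f; rewrite mem_enum.
Qed.

Lemma bseq_val_inj n : injective (fun b : n.-bseq 'I_n.+1 => [seq val i | i <- bseqval b]).
Proof. by move=> b1 b2 /inj_map /val_inj; apply; exact: val_inj. Qed.

Lemma compositions_uniq s : uniq (compositions s).
Proof. by rewrite filter_uniq// map_inj_uniq ?enum_uniq//; exact: bseq_val_inj. Qed.

Section Sums.
Variable R : nmodType.
Implicit Types f : seq nat -> R.

(** A [ctriple] stores its composition with bounds given by the whole graph rather than by its
    component; the sum does not depend on the bound. *)
Lemma sum_bseq_compositions n s (P : pred (seq nat)) f : (s <= n)%N ->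
  \sum_(b : n.-bseq 'I_n.+1 | is_composition s [seq val i | i <- bseqval b]
       && P [seq val i | i <- bseqval b]) f [seq val i | i <- bseqval b] =
  \sum_(al <- compositions s | P al) f al.
Proof.
move=> le_sn.
transitivity (\sum_(al <- [seq al <- [seq [seq val i | i <- bseqval b] |
    b : n.-bseq 'I_n.+1] | is_composition s al] | P al) f al).
  by rewrite big_filter_cond big_map /= big_enum_cond.
apply/perm_big/uniq_perm.
- by rewrite filter_uniq// map_inj_uniq ?enum_uniq//; exact: bseq_val_inj.
- exact: compositions_uniq.
move=> al; rewrite mem_compositions mem_filter andb_idr// => cal.
by have [b <-] := composition_bseqP le_sn cal; apply: map_f; rewrite mem_enum.
Qed.

Lemma sum_compositions0 f : \sum_(al <- compositions 0) f al = f [::].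
Proof.
rewrite (perm_big [:: [::]]) ?big_seq1//; apply: uniq_perm => //.
  exact: compositions_uniq.
by move=> al; rewrite mem_compositions composition0 inE.
Qed.

Lemma sum_compositions_rcons s f : (0 < s)%N ->
  \sum_(al <- compositions s) f al =
  \sum_(1 <= i < s.+1) \sum_(be <- compositions (s - i)) f (rcons be i).
Proof.
move=> s0; rewrite /index_iota subn1 /=.
rewrite -(@big_allpairs_dep _ _ _ _ _ _ (fun i be => rcons be i) _
  (fun i => compositions (s - i)) f).
apply/perm_big/uniq_perm; first exact: compositions_uniq.
  apply: allpairs_uniq_dep; first exact: iota_uniq.
    by move=> *; exact: compositions_uniq.
  by move=> [i be] [j ga] _ _ /= /rcons_inj[-> ->].
move=> al; rewrite mem_compositions.
apply/idP/allpairsPdep => [|[i [be []]]].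
  case/lastP: al => [|be i]; first by rewrite /is_composition eq_sym (gtn_eqF s0).
  rewrite composition_rcons => /and3P[i0 le_is cbe]; exists i, be.
  by rewrite mem_iota mem_compositions i0 add1n ltnS.
rewrite mem_iota mem_compositions add1n ltnS => /andP[i0 le_is] cbe ->.
by rewrite composition_rcons i0 le_is.
Qed.

Lemma sum_compositions_head s k f : (0 < k)%N ->
  \sum_(al <- compositions s | head 0%N al == k) f al =
  if (k <= s)%N then \sum_(be <- compositions (s - k)) f (k :: be) else 0.
Proof.
move=> k0; case: leqP => le_ks; last first.
  rewrite big_seq_cond big1// => al; rewrite mem_compositions => /andP[cal /eqP hal].
  case: al hal cal => /= [k_eq|i al ->]; first by rewrite -k_eq in k0.
  by rewrite composition_cons (leqNgt k) le_ks andbF.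
rewrite -[RHS](big_map (cons k) predT f) -[LHS]big_filter.
apply/perm_big/uniq_perm.
- exact/filter_uniq/compositions_uniq.
- by rewrite map_inj_uniq ?compositions_uniq// => a b [].
move=> al; rewrite mem_filter mem_compositions.
apply/andP/mapP => [[/eqP hal cal]|[be]]; last first.
  by rewrite mem_compositions => cbe ->; rewrite /= eqxx composition_cons k0 le_ks.
case: al hal cal => /= [k_eq|i al ->]; first by rewrite -k_eq in k0.
by rewrite composition_cons => /and3P[_ _ cal]; exists al => //; rewrite mem_compositions.
Qed.

Lemma sum_compositions_rev s f :
  \sum_(al <- compositions s) f al = \sum_(al <- compositions s) f (rev al).
Proof.
rewrite -[RHS](big_map rev predT f); apply/perm_big/uniq_perm.
- exact: compositions_uniq.
- by rewrite (map_inj_uniq (can_inj revK)) compositions_uniq.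
move=> al; have revc be : is_composition s (rev be) = is_composition s be.
  by rewrite /is_composition all_rev sumn_rev.
apply/idP/mapP => [cal|[be + ->]]; last by rewrite !mem_compositions revc.
by exists (rev al); rewrite ?revK// mem_compositions revc -mem_compositions.
Qed.

End Sums.

(** * Newton's recursions for sums over compositions *)

Section Newton.
Variables (R : comNzRingType) (e : nat -> R).

(* With [e] the elementary symmetric functions, [hsum] and [psum] are the complete
   homogeneous ones and (in positive degree) the power sums. *)
Definition signed_e (i : nat) : R := (-1) ^+ i.-1 * e i.
Definition eprod (al : seq nat) : R := \prod_(i <- al) signed_e i.
Definition hsum (s : nat) : R := \sum_(al <- compositions s) eprod al.
Definition psum (s : nat) : R := \sum_(al <- compositions s) eprod al *+ head 0%N al.

Lemma eprod_rcons al i : eprod (rcons al i) = signed_e i * eprod al.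
Proof. by rewrite /eprod -cats1 big_cat big_seq1 mulrC. Qed.

Lemma eprod_rev al : eprod (rev al) = eprod al.
Proof. by apply: perm_big; rewrite perm_rev. Qed.

(** The exponents [i.-1] of the parts add up to [s] minus the number of parts. *)
Lemma eprod_composition s al : is_composition s al ->
  eprod al = (-1) ^+ (s - size al) * \prod_(i <- al) e i.
Proof.
rewrite /eprod /signed_e big_split /= => cal; congr (_ * _).
rewrite -expr_sum; congr (_ ^+ _).
case/andP: cal => + /eqP <-; elim: al => [|i al IH] /=; first by rewrite big_nil.
move=> /andP[i0 al0]; rewrite big_cons IH//.
have := @composition_size (sumn al) al; rewrite /is_composition al0 eqxx => /(_ isT); lia.
Qed.

Lemma hsum0 : hsum 0 = 1.
Proof. by rewrite /hsum sum_compositions0 /eprod big_nil. Qed.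

(** Sorts the compositions by their last part [i]; this is the usual relation between elementary and
    complete homogeneous functions. *)
Lemma hsumE s : (0 < s)%N ->
  hsum s = \sum_(1 <= i < s.+1) signed_e i * hsum (s - i).
Proof.
move=> s0; rewrite /hsum sum_compositions_rcons//; apply: eq_bigr => i _.
by rewrite big_distrr; apply: eq_bigr => be _; rewrite eprod_rcons.
Qed.

(** Appending [i] leaves the head of a nonempty composition unchanged; only for [i = s] is the rest
    empty, so that the head is [i] itself. *)
Lemma sum_rcons_head s i : (0 < i <= s)%N ->
  \sum_(be <- compositions (s - i)) eprod (rcons be i) *+ head 0%N (rcons be i) =
  if i == s then signed_e s *+ s else signed_e i * psum (s - i).
Proof.
move=> /andP[i0 le_is]; case: eqP => [->|/eqP neq_is].
  by rewrite subnn sum_compositions0 /= /eprod big_seq1.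
rewrite big_distrr big_seq [RHS]big_seq; apply: eq_bigr => -[|j be] /=.
  by rewrite mem_compositions /is_composition /= => /eqP ?; lia.
by rewrite -rcons_cons eprod_rcons mulrnAr.
Qed.

(** Newton's identity, by the last part of the composition: the isolated term is the one with last
    part [s]. *)
Lemma psumE s : (0 < s)%N ->
  psum s = signed_e s *+ s + \sum_(1 <= i < s) signed_e i * psum (s - i).
Proof.
move=> s0; rewrite /psum sum_compositions_rcons// big_nat_recr//= addrC.
rewrite sum_rcons_head ?s0 ?leqnn// eqxx; congr (_ + _).
rewrite big_nat [RHS]big_nat; apply: eq_bigr => i /andP[i0 ltis].
by rewrite sum_rcons_head ?i0 1?ltnW// (ltn_eqF ltis).
Qed.

Lemma psum_last s :
  \sum_(al <- compositions s) eprod al *+ last 0%N al = psum s.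
Proof.
rewrite sum_compositions_rev; apply: eq_bigr => al _.
rewrite eprod_rev; congr (_ *+ _).
by case: al => //= i al; rewrite rev_cons last_rcons.
Qed.

(** The compositions subtracted are those with last part [i <= q]; since [q < s], something is left
    in front of that part and carries the head. *)
Lemma sum_le_last s q : (q < s)%N ->
  \sum_(al <- compositions s | (q < last 0 al)%N) eprod al *+ head 0%N al =
  psum s - \sum_(1 <= i < q.+1) signed_e i * psum (s - i).
Proof.
move=> lt_qs; apply/esym/eqP; rewrite subr_eq; apply/eqP.
rewrite {1}/psum (bigID (fun al => (q < last 0 al)%N)) /=; congr (_ + _).
rewrite big_mkcond sum_compositions_rcons ?(leq_ltn_trans _ lt_qs)//=.
rewrite (@big_cat_nat _ _ _ q.+1)//= ?ltnS 1?ltnW// [X in _ + X]big_nat.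
rewrite [X in _ + X]big1 ?addr0; last first.
  move=> i /andP[lt_qi _]; rewrite big1// => be _.
  by rewrite last_rcons lt_qi.
rewrite big_nat [RHS]big_nat; apply: eq_bigr => i /andP[i0 le_iq].
transitivity (\sum_(be <- compositions (s - i))
    eprod (rcons be i) *+ head 0%N (rcons be i)).
  by apply: eq_bigr => be _; rewrite last_rcons ltnNge -ltnS le_iq.
rewrite sum_rcons_head; last by lia.
by rewrite ltn_eqF//; lia.
Qed.

(** By [sum_le_last] the left side is a linear combination of the [psum (b + j)] with [j < a]. The
    coefficient at [j] is [hsum (a - j.+1)] minus its own expansion by [hsumE]; only for [j = a.-1]
    is there no expansion, and [hsum 0 = 1] survives. *)
Lemma sum_hsum_psum a b : (0 < a)%N -> (0 < b)%N ->
  \sum_(0 <= q < a) hsum (a - q.+1) *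
    (\sum_(al <- compositions (b + q) | (q < last 0 al)%N) eprod al *+ head 0%N al) =
  psum (a + b).-1.
Proof.
move=> a0 b0.
transitivity (\sum_(0 <= q < a) (hsum (a - q.+1) * psum (b + q) -
   \sum_(0 <= j < q) hsum (a - q.+1) * signed_e (q - j) * psum (b + j))).
  rewrite big_nat [RHS]big_nat; apply: eq_bigr => q /andP[_ lt_qa].
  rewrite sum_le_last; last by lia.
  (* The substitution [i = q - j] turns the subtracted terms into multiples of [psum (b + j)]. *)
  rewrite mulrBr; congr (_ - _); rewrite big_add1 /= big_distrr /= big_nat_rev /=.
  rewrite big_nat [RHS]big_nat; apply: eq_bigr => j /andP[_ lt_jq].
  rewrite mulrA; congr (_ * signed_e _ * psum _); lia.
rewrite sumrB.

(* The coefficient of [psum (b + j)] vanishes for [j < a.-1], by [hsumE]. *)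
have -> : \sum_(0 <= q < a) \sum_(0 <= j < q) hsum (a - q.+1) * signed_e (q - j) * psum (b + j) =
          \sum_(0 <= j < a)
            (\sum_(j.+1 <= q < a) hsum (a - q.+1) * signed_e (q - j)) * psum (b + j).
  transitivity (\sum_(0 <= q < a) \sum_(0 <= j < a | (j < q)%N)
      hsum (a - q.+1) * signed_e (q - j) * psum (b + j)).
    rewrite big_nat [RHS]big_nat; apply: eq_bigr => q /andP[_ lt_qa].
    by rewrite (big_nat_widen _ _ a)// ltnW.
  rewrite (exchange_big_dep predT)//=; apply: eq_bigr => j _.
  by rewrite big_distrl /= (@big_nat_widenl _ _ _ j.+1 0)//.
rewrite -sumrB; under eq_bigr do rewrite -mulrBl.
rewrite -(prednK a0) big_nat_recr//= big_nat big1 ?add0r.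
  by rewrite subnn hsum0 big_geq// subr0 mul1r; congr psum; lia.
move=> j /andP[_ lt_ja]; rewrite hsumE; last by lia.
rewrite (big_addn 1 _ j) (_ : a.-1.+1 - j = (a.-1.+1 - j.+1).+1)%N; last by lia.
rewrite (_ : _ - _ = 0) ?mul0r//; apply/eqP; rewrite subr_eq0; apply/eqP.
rewrite [LHS]big_nat [RHS]big_nat; apply: eq_bigr => i ltia.
by rewrite mulrC addnK; congr (hsum _ * _); lia.
Qed.
End Newton.

(** * Newton's identities in finitely many variables *)

Section PowerSums.
Variables (R : comNzRingType) (x : nat -> R).

(** The elementary symmetric polynomial of degree [k] in the first [B] variables, split by whether
    the last one occurs. *)
Fixpoint elem (B k : nat) : R :=
  match B, k with
  | 0, _ => (k == 0%N)%:R
  | _.+1, 0 => 1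
  | B'.+1, k'.+1 => elem B' k'.+1 + x B' * elem B' k'
  end.

Definition power_sum (B s : nat) : R := \sum_(i < B) x i ^+ s.

Lemma elem0 B : elem B 0 = 1.
Proof. by case: B. Qed.

(** The coefficient of T^i in the product of the factors [1 - x j T] over [j < B]; [vS] multiplies
    by the last factor. *)
Let v B i : R := (-1) ^+ i * elem B i.

Let v0 B : v B 0 = 1.
Proof. by rewrite /v elem0 mulr1. Qed.

Let vS B i : v B.+1 i.+1 = v B i.+1 - x B * v B i.
Proof. rewrite /v /= !exprS; ring. Qed.

(** Compares coefficients of T^(r+1): the denominator of the geometric series [x B T / (1 - x B T)]
    cancels the last factor of the generating polynomial. *)
Let sum_v_exp B r : \sum_(i < r.+1) v B.+1 i * x B ^+ (r.+1 - i) = v B r * x B.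
Proof.
elim: r => [|r IH]; first by rewrite big_ord1 !v0 subn0.
rewrite big_ord_recr /=.
have -> : \sum_(i < r.+1) v B.+1 i * x B ^+ (r.+2 - i) =
    x B * \sum_(i < r.+1) v B.+1 i * x B ^+ (r.+1 - i).
  by rewrite big_distrr; apply: eq_bigr => i _ /=; rewrite subSn 1?ltnW// exprS; ring.
rewrite IH vS subSnn; ring.
Qed.

(** Induction on the number of variables. The new variable adds the terms summed by [sum_v_exp];
    expanding [v B.+1] by [vS] reduces the other ones to the identities for [B] in degrees [r.+1]
    and [r]. *)
Lemma newton_identity B s :
  \sum_(i < s) (-1) ^+ i * elem B i * power_sum B (s - i) +
  (-1) ^+ s * elem B s *+ s = 0.
Proof.
rewrite -/(v B s); under eq_bigr do rewrite -/(v B _).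
elim: B s => [|B IH] s.
  rewrite big1 => [|i _]; last by rewrite /power_sum big_ord0 mulr0.
  by case: s => [|s]; rewrite ?mulr0n ?addr0// /v /= mulr0 mul0rn addr0.
case: s => [|r]; first by rewrite big_ord0 mulr0n addr0.
have PS k : power_sum B.+1 k = power_sum B k + x B ^+ k.
  by rewrite /power_sum big_ord_recr.
under eq_bigr do rewrite PS mulrDr.
rewrite big_split /= sum_v_exp.
have -> : \sum_(i < r.+1) v B.+1 i * power_sum B (r.+1 - i) =
   \sum_(i < r.+1) v B i * power_sum B (r.+1 - i) -
   x B * \sum_(i < r) v B i * power_sum B (r - i).
  rewrite 2![\sum_(i < r.+1) _]big_ord_recl !v0 -addrA; congr (_ + _).
  rewrite big_distrr -sumrB; apply: eq_bigr => i _ /=.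
  by rewrite /bump /= add1n vS subSS; ring.
have := IH r.+1; have := IH r; set S1 := \sum_(i < r) _; set S2 := \sum_(i < r.+1) _.
move=> /eqP; rewrite addr_eq0 => /eqP -> /eqP; rewrite addr_eq0 => /eqP ->.
rewrite vS; ring.
Qed.

(** [psumE] and Newton's identity solved for its term [i = 0] are the same recursion. *)
Lemma psum_power_sum B s : (0 < s)%N -> psum (elem B) s = power_sum B s.
Proof.
have [m] := ubnP s; elim: m s => // m IH [//|s] lt_sm _.
rewrite psumE// big_add1 /= big_mkord; have := newton_identity B s.+1.
rewrite big_ord_recl /= elem0 !mul1r -addrA => /eqP; rewrite addr_eq0 => /eqP ->.
rewrite opprD addrC /signed_e /= exprS mulN1r mulNr mulNrn opprK; congr (_ + _).
rewrite -sumrN; apply: eq_bigr => i _; rewrite IH; last 2 first.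
- by have := ltn_ord i; lia.
- by have := ltn_ord i; lia.
by rewrite /bump add1n exprS; ring.
Qed.

End PowerSums.

Arguments elem : simpl never.

(** * The contribution of a single component *)

Section ComponentSums.
Variables (R : comNzRingType) (e : nat -> R).

(* The contribution of one component with [s] vertices to the diagonal entry of index
   [q.+1]; [b0] and [bn] tell whether it contains the first vertex, resp. the path. *)
Definition component_sum (b0 bn : bool) (q s : nat) : R :=
  \sum_(al <- compositions s |
      (b0 ==> (head 0%N al == q.+1)) && (bn ==> (q < last 0%N al)%N))
    ((-1) ^+ (s - size al) * \prod_(i <- if b0 then behead al else al) e i)
      *+ (if b0 then 1%N else head 0%N al).

(** Counts the choices of [r] in a triple whose composition starts with [h]; they produce the factor
    [head 0 al]. *)
Lemma card_ord_range n h : (h <= n)%N -> #|[pred r : 'I_n.+1 | (0 < r <= h)%N]| = h.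
Proof.
move=> le_hn; rewrite -sum1_card (eq_bigl (fun r : 'I_n.+1 => (0 < r <= h)%N))//.
rewrite -(big_mkord (fun r => (0 < r <= h)%N) (fun _ => 1%N)).
rewrite big_ltn_cond// ltnn /=.
rewrite big_nat_cond (eq_bigl (fun r => (1 <= r < h.+1)%N)); last by move=> r; lia.
rewrite (@big_cat_nat _ _ _ h.+1) ?ltnS//= [X in (_ + X)%N]big_nat_cond.
rewrite [X in (_ + X)%N]big_pred0; last by move=> r; lia.
by rewrite -big_nat sum_nat_const_nat subSS subn0 muln1 addn0.
Qed.

(** The summand does not involve [r = d.2], which takes as many values as the head of the
    composition indicates, or a single one when [b0] forces [r = 1]. *)
Lemma sum_data n (b0 bn : bool) q s : (s <= n)%N ->
  \sum_(d : n.-bseq 'I_n.+1 * 'I_n.+1 |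
      [&& is_composition s (map val d.1), 1 <= d.2 <= head 0 (map val d.1),
          b0 ==> (head 0 (map val d.1) == q.+1) && (d.2 == 1 :> nat) &
          bn ==> (q < last 0 (map val d.1))]%N)
    (-1) ^+ (s - size (map val d.1)) *
      \prod_(i <- if b0 then behead (map val d.1) else map val d.1) e i =
  component_sum b0 bn q s.
Proof.
move=> le_sn; rewrite /component_sum -(sum_bseq_compositions _ _ le_sn).
rewrite (eq_bigl (fun d : n.-bseq 'I_n.+1 * 'I_n.+1 =>
   [&& is_composition s (map val d.1),
     b0 ==> (head 0%N (map val d.1) == q.+1) & bn ==> (q < last 0 (map val d.1))%N] &&
   ((1 <= d.2 <= head 0 (map val d.1)) && (b0 ==> (d.2 == 1 :> nat)))%N)); last first.
  move=> [b r] /=; case: (is_composition _ _); case: (0 < r <= _)%N;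
    case: (head _ _ == _); case: (nat_of_ord r == _); case: (q < _)%N;
    by case: b0; case: bn.
rewrite -(pair_big_dep
  (fun b : n.-bseq 'I_n.+1 => [&& is_composition s (map val b),
     b0 ==> (head 0%N (map val b) == q.+1) & bn ==> (q < last 0 (map val b))%N])
  (fun b (r : 'I_n.+1) => ((1 <= r <= head 0 (map val b)) && (b0 ==> (r == 1 :> nat)))%N)
  (fun b r => (-1) ^+ (s - size (map val b)) *
      \prod_(i <- if b0 then behead (map val b) else map val b) e i)) /=.
apply: eq_bigr => b /and3P[cb h0 _]; rewrite sumr_const; congr (_ *+ _).
have le_hn : (head 0 (map val b) <= n)%N.
  case E: (map val b) => [//|i al] /=; apply: leq_trans le_sn.
  by apply: composition_part cb _; rewrite E mem_head.
case: b0 h0 => /= [/eqP h0|_]; last first.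
  by rewrite -[RHS](card_ord_range le_hn); apply: eq_card => r; rewrite !inE /=; lia.
rewrite -[RHS](@card_ord_range n 1); last by rewrite h0 in le_hn; lia.
by apply: eq_card => r; rewrite !inE; rewrite h0 /=; lia.
Qed.

Lemma component_sum_ff q s : component_sum false false q s = psum e s.
Proof.
rewrite /component_sum /psum big_seq [RHS]big_seq; apply: eq_bigr => al.
by rewrite mem_compositions => /eprod_composition ->.
Qed.

Lemma component_sum_ft q s : component_sum false true q s =
  \sum_(al <- compositions s | (q < last 0 al)%N) eprod e al *+ head 0%N al.
Proof.
rewrite /component_sum big_seq_cond [RHS]big_seq_cond; apply: eq_bigr => al.
by rewrite mem_compositions => /andP[/eprod_composition ->].
Qed.

(** The head [q.+1] is prescribed and left out of the product; [be] is the rest, and the sign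
    changes by [(-1) ^+ q]. The default [q.+1] of [last] covers an empty [be]: the last part is then
    the head. *)
Lemma component_sum_t bn q s : component_sum true bn q s =
  if (q < s)%N then (-1) ^+ q * \sum_(be <- compositions (s - q.+1) |
     bn ==> (q < last q.+1 be)%N) eprod e be else 0.
Proof.
rewrite /component_sum big_mkcondr sum_compositions_head//=; case: ltnP => // lt_qs.
rewrite -big_mkcond big_distrr big_seq_cond [RHS]big_seq_cond; apply: eq_bigr => be.
rewrite mem_compositions => /andP[cbe _]. rewrite (eprod_composition e cbe) /= mulrA -exprD.
by congr (_ ^+ _ * _); have := composition_size cbe; lia.
Qed.

Lemma sum_component_sum_tt M c : (0 < c <= M)%N ->
  \sum_(q < M) (-1) ^+ q * component_sum true true q (c.+1 + q) = psum e c.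
Proof.
move=> /andP[c0 le_cM].
transitivity (\sum_(q < M) \sum_(be <- compositions c | (q < last 0 be)%N) eprod e be).
  apply: eq_bigr => q _; rewrite component_sum_t.
  rewrite ifT; last by lia.
  rewrite mulrA -signr_odd -exprMn mulrN mulr1 opprK expr1n mul1r.
  rewrite (_ : c.+1 + q - q.+1 = c)%N; last by lia.
  (* As [c > 0], [be] is nonempty, so [last] returns a true part whatever its default. *)
  rewrite big_seq_cond [RHS]big_seq_cond; apply: eq_bigl => be.
  rewrite mem_compositions; case: be => [|//] /=.
  by rewrite /is_composition /=; lia.
rewrite (exchange_big_dep predT)//= -psum_last big_seq [RHS]big_seq.
apply: eq_bigr => be; rewrite mem_compositions => cbe.
rewrite sumr_const; congr (_ *+ _).
have le_lM : (last 0 be <= M)%N.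
  case: be cbe => [//|i be] /composition_part cbe; apply: leq_trans le_cM.
  exact/cbe/mem_last.
rewrite -sum1_card -(big_ord_widen_cond _ predT (fun _ => 1%N) le_lM).
by rewrite sum_nat_const card_ord muln1.
Qed.

(** Up to the sign [(-1) ^+ q], the component of the first vertex contributes [hsum (a - q.+1)], and
    0 for [q >= a]; this leaves the convolution of [sum_hsum_psum]. *)
Lemma sum_component_sum_tf_ft M a b : (0 < a <= M)%N -> (0 < b)%N ->
  \sum_(q < M) (-1) ^+ q * component_sum true false q a * component_sum false true q (b + q) =
  psum e (a + b).-1.
Proof.
move=> /andP[a0 le_aM] b0; rewrite -(sum_hsum_psum e a0 b0) big_mkord.
rewrite (big_ord_widen _ (fun q => hsum e (a - q.+1) * (\sum_(al <- compositions (b + q) |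
  (q < last 0 al)%N) eprod e al *+ head 0%N al)) le_aM) [RHS]big_mkcond.
apply: eq_bigr => q _; rewrite component_sum_ft component_sum_t /=.
case: ifP => _; last by rewrite mulr0 mul0r.
by rewrite mulrA -signr_odd -exprMn mulrN mulr1 opprK expr1n mul1r.
Qed.
End ComponentSums.

(** * Components of an edge set *)

Section Components.
Variable V : finType.
Implicit Types (F : {set {set V}}) (u v : V) (W e : {set V}).

Definition adjacent F u v := [set u; v] \in F.
Definition component F v : {set V} := [set u | connect (adjacent F) v u].
Definition components F : {set {set V}} := [set component F v | v in [set: V]].
Definition induced F W : {set {set V}} := [set e in F | e \subset W].

Lemma connect_invariant (r : rel V) (A : {set V}) u v :
  (forall x y, x \in A -> r x y -> y \in A) -> connect r u v -> u \in A -> v \in A.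
Proof.
move=> Ar /connectP[p + ->]; elim: p u => //= y p IH u /andP[ruy py] uA.
exact: IH py (Ar _ _ uA ruy).
Qed.

Lemma adjacent_connect_sym F : connect_sym (adjacent F).
Proof. by apply: sym_connect_sym => u v; rewrite /adjacent finset.setUC. Qed.

Lemma component_id F v : v \in component F v.
Proof. by rewrite inE connect0. Qed.

Lemma mem_component F u v : (u \in component F v) = (component F u == component F v).
Proof.
rewrite inE; apply/idP/eqP => [uv|E]; last first.
  by have := component_id F u; rewrite E inE.
apply/setP => w; rewrite !inE.
by rewrite (same_connect (adjacent_connect_sym F) uv).
Qed.

Lemma component_components F v : component F v \in components F.
Proof. by apply/imsetP; exists v. Qed.

Lemma componentsP F W v : W \in components F -> (v \in W) = (component F v == W).
Proof. by case/imsetP => u _ ->; rewrite mem_component. Qed.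

Lemma components_neq0 F W : W \in components F -> exists v, v \in W.
Proof. by case/imsetP => u _ ->; exists u; exact: component_id. Qed.

Lemma components_eq F W W' v : W \in components F -> W' \in components F ->
  v \in W -> v \in W' -> W = W'.
Proof. by move=> WF W'F; rewrite !(componentsP _ WF, componentsP _ W'F) => /eqP<- /eqP. Qed.

Lemma edge_sub_component F e v : #|e| == 2 -> e \in F -> v \in e -> e \subset component F v.
Proof.
move=> /cards2P[a [b [_ ->]]] eF.
have ab : component F a = component F b.
  by apply/esym/eqP; rewrite -mem_component inE connect1.
rewrite finset.subUset !finset.sub1set !mem_component !finset.in_set2.
by case/orP => /eqP ->; rewrite ab !eqxx.
Qed.

Lemma prod_components (R : comNzRingType) F (g : V -> {set V} -> R) :
  \prod_v g v (component F v) = \prod_(W in components F) \prod_(v in W) g v W.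
Proof.
rewrite (eq_bigl (mem [set: V])); last by move=> v; rewrite /= inE.
rewrite (partition_big_imset (component F)) /=; apply: eq_bigr => W WF.
rewrite (eq_bigl (mem W)) => [|v] /=; last by rewrite (componentsP _ WF) finset.in_setT.
by apply: eq_bigr => v; rewrite (componentsP _ WF) => /eqP ->.
Qed.

Definition monochromatic (I : finType) F (kappa : {ffun V -> I}) :=
  [forall e in F, forall u in e, forall v in e, kappa u == kappa v].

(** A coloring constant on every edge is constant on every component, so it amounts to one color per
    component, chosen independently; distributivity gives the product. *)
Lemma sum_monochromatic (R : comNzRingType) (I : finType) (i0 : I) F (w : V -> I -> R) :
  (forall e, e \in F -> #|e| == 2) ->
  \sum_(kappa : {ffun V -> I} | monochromatic F kappa) \prod_v w v (kappa v) =
  \prod_(W in components F) \sum_i \prod_(v in W) w v i.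
Proof.
move=> F2; rewrite (big_distr_big_dep i0 _ (fun _ => predT)) /=.
(* Expanding the product yields functions on all vertex sets, with value [i0] off the components;
   [col] and [val_on] translate them into colorings and back. *)
pose col (f : {ffun {set V} -> I}) : {ffun V -> I} := [ffun v => f (component F v)].
pose val_on (kappa : {ffun V -> I}) : {ffun {set V} -> I} :=
  [ffun W : {set V} => if [pick v in W] is Some v then
               if W \in components F then kappa v else i0 else i0].
have val_onK f W : W \in components F -> val_on (col f) W = f W.
  move=> WF; rewrite ffunE; case: pickP => [v|W0]; last first.
    by have [v] := components_neq0 WF; rewrite W0.
  by rewrite WF ffunE (componentsP _ WF) => /eqP ->.
rewrite (reindex_onto col val_on) => [|kappa mk]; last first.
  apply/ffunP => v; rewrite !ffunE component_components.
  case: pickP => [u|/(_ v)]; last by rewrite component_id.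
  move=> uv; apply/eqP; move: uv; rewrite inE => uv.
  suff : u \in [set x | kappa x == kappa v] by rewrite inE.
  apply: connect_invariant uv _; last by rewrite inE.
  move=> x y; rewrite !inE => /eqP <- xyF.
  by apply: (forall_inP (forall_inP (forall_inP mk _ xyF) y _) x _); rewrite !inE eqxx ?orbT.
apply: eq_big => [f|f _]; last first.
  rewrite -(prod_components F (fun v W => w v (f W))).
  by apply: eq_bigr => v _; rewrite ffunE.
apply/andP/familyP => [[_ /eqP vf] W|ff].
  rewrite /=; case: ifP => //= WF; rewrite -vf ffunE.
  by case: pickP => [v _|_]; [rewrite WF|]; exact: eqxx.
split.
  apply/forall_inP => e eF; apply/forall_inP => u ue; apply/forall_inP => v ve.
  rewrite !ffunE; apply/eqP; congr (f _); apply/eqP.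
  by rewrite -mem_component (subsetP (edge_sub_component (F2 _ eF) eF ve)).
apply/eqP/ffunP => W; case: (boolP (W \in components F)) => WF; first exact: val_onK.
have := ff W; rewrite /=; case: ifP => [WF'|_ /eqP ->]; first by case/negP: WF.
by rewrite ffunE (negPf WF); case: pickP.
Qed.

End Components.

(** * Subgraph triples *)

Section Triples.
Variables (n : nat) (H : sgraph n).
Implicit Types (F : {set {set 'I_n}}) (W : {set 'I_n}) (S : {set ctriple n}).

Let data : finType := (n.-bseq 'I_n.+1 * 'I_n.+1)%type.

Lemma edges_eq2 F e : F \subset edges H -> e \in F -> #|e| == 2.
Proof. by move=> FH eF; exact: (forall_inP (edges_card2 H) _ (subsetP FH _ eF)). Qed.

Lemma edge_has_vertex F e : F \subset edges H -> e \in F -> exists v, v \in e.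
Proof.
move=> FH /(edges_eq2 FH) /eqP e2; apply/set0Pn.
by rewrite -card_gt0 e2.
Qed.

Lemma connected_component F W : F \subset edges H -> W \in components F ->
  connected_subgraph H W (induced F W).
Proof.
move=> FH WF; apply/and4P; split.
- by have [v vW] := components_neq0 WF; apply/set0Pn; exists v.
- by apply: subset_trans FH; apply/subsetP => e; rewrite inE => /andP[].
- by apply/forall_inP => e; rewrite inE => /andP[].
apply/forall_inP => u uW; apply/forall_inP => v.
have := uW; rewrite (componentsP _ WF) => /eqP WE; rewrite -{1}WE inE => uv.
(* Membership in [W] is part of the invariant: it puts each edge of the walk into [induced F W]. *)
suff : v \in W :&: [set x | connect (adjacent (induced F W)) u x] by rewrite !inE => /andP[].
apply: connect_invariant uv _; last by rewrite !inE uW connect0.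
move=> x y; rewrite !inE => /andP[xW ux] xy.
have exyW : [set x; y] \subset W.
  have := xW; rewrite (componentsP _ WF) => /eqP <-.
  by apply: edge_sub_component (edges_eq2 FH xy) xy _; rewrite !inE eqxx.
apply/andP; split; first by apply: (subsetP exyW); rewrite !inE eqxx orbT.
by apply: connect_trans ux (connect1 _); rewrite /adjacent inE exyW andbT.
Qed.

(** A subgraph triple is determined by its set of edges [F] and a choice of composition and [r] for
    each component of [F]: its connected pieces are these components, with all the edges of [F]
    inside them. *)
Definition triple F W (d : data) : ctriple n := (W, induced F W, d.1, d.2).

Definition triples_of F (f : {ffun {set 'I_n} -> data}) : {set ctriple n} :=
  [set triple F W (f W) | W in components F].

Definition edge_set S : {set {set 'I_n}} := \bigcup_(c in S) cedges c.

(** The value at other vertex sets is the default that [big_distr_big_dep] prescribes in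
    [sum_ST]. *)
Definition data_of S : {ffun {set 'I_n} -> data} :=
  [ffun W : {set 'I_n} => if [pick c in S | cverts c == W] is Some c then (c.1.2, c.2)
     else (nil_bseq _ _, ord0)].

Section FromST.
Variable S : {set ctriple n}.
Hypothesis SH : S \in ST H.

Lemma ST_is_ctriple c : c \in S -> is_ctriple H c.
Proof. by move: SH; rewrite inE => /and3P[/forall_inP + _ _]; apply. Qed.

Lemma ST_eq c d v : c \in S -> d \in S -> v \in cverts c -> v \in cverts d -> c = d.
Proof.
move=> cS dS vc vd; apply/eqP/negPn/negP => cd.
move: SH; rewrite inE => /and3P[_ /forall_inP/(_ c cS)/forall_inP/(_ d dS)/implyP/(_ cd) + _].
by rewrite disjoint_subset => /subsetP/(_ v vc); rewrite inE vd.
Qed.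

Lemma ST_cover v : exists2 c, c \in S & v \in cverts c.
Proof.
move: SH; rewrite inE => /and3P[_ _ /eqP cS].
by have : v \in [set: 'I_n] by []; rewrite -cS => /bigcupP.
Qed.

Lemma ST_cedges c : c \in S ->
  [/\ cverts c != finset.set0, cedges c \subset edges H,
      forall e, e \in cedges c -> e \subset cverts c &
      forall u v, u \in cverts c -> v \in cverts c -> connect (adjacent (cedges c)) u v].
Proof.
move=> /ST_is_ctriple/and3P[/and4P[c0 cH /forall_inP cc cx] _ _]; split => // u v uc vc.
exact: (forall_inP (forall_inP cx _ uc) _ vc).
Qed.

Lemma edge_set_sub : edge_set S \subset edges H.
Proof. by apply/bigcupsP => c /ST_cedges[]. Qed.

Lemma edge_setP e v c : e \in edge_set S -> c \in S -> v \in e -> v \in cverts c ->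
  e \in cedges c.
Proof.
move=> /bigcupP[d dS ed] cS ve vc; have [_ _ dd _] := ST_cedges dS.
by rewrite (ST_eq cS dS vc)// (subsetP (dd _ ed)).
Qed.

(** Edges of the other triples do not meet [cverts c], so no walk leaves it; its own edges connect
    it. *)
Lemma component_edge_set c v : c \in S -> v \in cverts c ->
  component (edge_set S) v = cverts c.
Proof.
move=> cS vc; have [_ _ cc cx] := ST_cedges cS; apply/setP => u; apply/idP/idP.
  rewrite inE => vu; apply: connect_invariant vu vc => x y xc xy.
  by apply: (subsetP (cc _ (edge_setP xy cS _ xc))); rewrite !inE eqxx ?orbT.
move=> uc; rewrite inE; apply: (connect_sub _ (cx _ _ vc uc)) => x y xy.
by apply: connect1; apply/bigcupP; exists c.
Qed.

Lemma cverts_components c : c \in S -> cverts c \in components (edge_set S).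
Proof.
move=> cS; have [/set0Pn[v vc] _ _ _] := ST_cedges cS.
by rewrite -(component_edge_set cS vc) component_components.
Qed.

(** The vertex sets being disjoint, an edge of [S] inside [cverts c] can come from no other
    triple. *)
Lemma cedges_induced c : c \in S -> cedges c = induced (edge_set S) (cverts c).
Proof.
move=> cS; have [_ _ cc _] := ST_cedges cS; apply/setP => e; rewrite inE.
apply/idP/andP => [ec|[eS ec]]; first by split; [apply/bigcupP; exists c | exact: cc].
have [v ve] := edge_has_vertex edge_set_sub eS.
exact: edge_setP eS cS ve (subsetP ec _ ve).
Qed.

Lemma data_of_triple c : c \in S -> triple (edge_set S) (cverts c) (data_of S (cverts c)) = c.
Proof.
move=> cS; rewrite /data_of ffunE; case: pickP => [d /andP[dS /eqP dc]|/(_ c)]; last first.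
  by rewrite cS eqxx.
have -> : d = c.
  have [/set0Pn[v vc] _ _ _] := ST_cedges cS.
  by apply: (ST_eq dS cS (v := v)); rewrite ?dc.
by rewrite /triple -cedges_induced//; case: c {cS dc} => -[[]].
Qed.

Lemma triples_of_data : triples_of (edge_set S) (data_of S) = S.
Proof.
apply/setP => c; apply/imsetP/idP => [[W WS ->]|cS]; last first.
  by exists (cverts c); rewrite ?cverts_components// data_of_triple.
have [v vW] := components_neq0 WS; have [d dS vd] := ST_cover v.
have -> : W = cverts d.
  by apply: components_eq WS (cverts_components dS) vW vd.
by rewrite data_of_triple.
Qed.

End FromST.

Section ToST.
Variables (F : {set {set 'I_n}}) (f : {ffun {set 'I_n} -> data}).
Hypothesis FH : F \subset edges H.

Lemma triples_of_ST :
  (forall W, W \in components F -> is_ctriple H (triple F W (f W))) -> triples_of F f \in ST H.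
Proof.
move=> fH; rewrite inE; apply/and3P; split.
- by apply/forall_inP => _ /imsetP[W WF ->]; exact: fH.
- apply/forall_inP => _ /imsetP[W WF ->]; apply/forall_inP => _ /imsetP[W' W'F ->].
  apply/implyP => WW'; rewrite -setI_eq0; apply/eqP/setP => v; rewrite !inE /cverts /=.
  apply/negP => /andP[vW vW']; case/negP: WW'.
  by rewrite (components_eq WF W'F vW vW').
apply/eqP/setP => v; rewrite inE; apply/bigcupP; rewrite /cverts.
exists (triple F (component F v) (f (component F v))); last exact: component_id.
by apply/imsetP; exists (component F v) => //; exact: component_components.
Qed.

Lemma edge_set_triples : edge_set (triples_of F f) = F.
Proof.
apply/setP => e; apply/bigcupP/idP => [[_ /imsetP[W WF ->]]|eF].
  by rewrite /cedges inE => /andP[].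
have [v ve] := edge_has_vertex FH eF.
exists (triple F (component F v) (f (component F v))).
  by apply/imsetP; exists (component F v) => //; exact: component_components.
by rewrite /cedges inE eF (edge_sub_component (edges_eq2 FH eF)).
Qed.

Lemma triple_inj : {in components F &, injective (fun W => triple F W (f W))}.
Proof. by move=> W W' _ _ /(congr1 (@cverts n)). Qed.

Lemma data_of_triples W :
  data_of (triples_of F f) W = if W \in components F then f W else (nil_bseq _ _, ord0).
Proof.
rewrite ffunE; case: pickP => [_ /andP[/imsetP[W' W'F ->] /eqP <-]|noc].
  by rewrite /cverts /= W'F; case: (f W').
case: ifP => // WF; have := noc (triple F W (f W)).
by rewrite /cverts /= eqxx andbT => /imsetP[]; exists W.
Qed.

Lemma st_edges_triples : st_edges (triples_of F f) = #|F|.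
Proof.
rewrite /st_edges big_imset; last exact: triple_inj.
rewrite /cedges /= (eq_bigr (fun W => \sum_(e in F | e \subset W) 1)%N); last first.
  by move=> W _; rewrite -sum1_card; apply: eq_bigl => e; rewrite inE.
rewrite (exchange_big_dep (mem F))/= => [|W e _ /andP[]//].
rewrite -sum1_card; apply: eq_bigr => e eF.
have [v ve] := edge_has_vertex FH eF.
rewrite (big_pred1 (component F v))// => W /=; rewrite eF /=.
apply/andP/eqP => [[WF /subsetP/(_ v ve)]|->].
  by rewrite (componentsP _ WF) => /eqP.
by rewrite component_components (edge_sub_component (edges_eq2 FH eF)).
Qed.

End ToST.

(** Once the edge set is fixed, the data of its components are chosen independently, so
    distributivity turns the sum over them into a product; [phi] depends on the edge set only. *)
Lemma sum_ST (R : comNzRingType) (ok : pred (ctriple n)) (phi : nat -> R) (g : ctriple n -> R) :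
  \sum_(S in ST H | [forall c in S, ok c]) phi (st_edges S) * \prod_(c in S) g c =
  \sum_(F : {set {set 'I_n}} | F \subset edges H) phi #|F| *
    \prod_(W in components F)
      \sum_(d | is_ctriple H (triple F W d) && ok (triple F W d)) g (triple F W d).
Proof.
rewrite (partition_big edge_set (fun F => F \subset edges H)) /=; last first.
  by move=> S /andP[SH _]; exact: edge_set_sub.
apply: eq_bigr => F FH; rewrite (big_distr_big_dep (nil_bseq _ _, ord0)) big_distrr /=.
rewrite (reindex_onto (triples_of F) data_of) => [|S /andP[/andP[SH _] /eqP <-]]; last first.
  exact: triples_of_data.
apply: eq_big => [f|f _]; last first.
  by rewrite st_edges_triples// big_imset//; exact: triple_inj.
rewrite edge_set_triples// eqxx andbT.
apply/andP/familyP => [[/andP[SH /forall_inP Sok] /eqP ff] W|ff].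
  rewrite /=; case: ifP => WF; last first.
    by rewrite -ff data_of_triples; case: ifP => [WF'|_]; [by case/negP: (negbT WF)|exact: eqxx].
  have cS : triple F W (f W) \in triples_of F f by apply/imsetP; exists W.
  by apply/andP; split; [exact: (ST_is_ctriple SH cS) | exact: Sok].
have fW W : W \in components F -> is_ctriple H (triple F W (f W)) && ok (triple F W (f W)).
  by move=> WF; have := ff W; rewrite /=; case: ifP => // WF'; case/negP: (negbT WF').
split.
  apply/andP; split; first by apply: triples_of_ST => W /fW/andP[].
  by apply/forall_inP => _ /imsetP[W WF ->]; have /andP[] := fW _ WF.
apply/eqP/ffunP => W; rewrite data_of_triples; case: ifP => // WF.
have := ff W; rewrite /=; case: ifP => [WF'|_ /eqP ->//]; by case/negP: (negbT WF).
Qed.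

End Triples.

(** * Sign and reduced type as a product over the triples *)

Section Weights.
Variables (n : nat) (H : sgraph n.+1) (R : comNzRingType) (e : nat -> R).
Implicit Types (S : {set ctriple n.+1}) (c : ctriple n.+1).

Definition reduced_alpha c : seq nat :=
  if ord0 \in cverts c then behead (calpha c) else calpha c.

Definition triple_weight c : R :=
  (-1) ^+ (#|cverts c| - size (calpha c)) * \prod_(i <- reduced_alpha c) e i.

Lemma count_flatten_enum S (a : pred nat) (f : ctriple n.+1 -> seq nat) :
  count a (flatten [seq f c | c <- enum S]) = (\sum_(c in S) count a (f c))%N.
Proof. by rewrite count_flatten sumnE !big_map big_enum. Qed.

Lemma sum_cverts S : S \in ST H -> (\sum_(c in S) #|cverts c| = n.+1)%N.
Proof.
move=> SH; rewrite -[RHS]card_ord -sum1_card.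
under eq_bigr do rewrite -sum1_card.
rewrite (exchange_big_dep predT) //=; apply: eq_bigr => v _.
have [c cS vc] := ST_cover SH v.
rewrite (big_pred1 c)// => d /=; apply/andP/eqP => [[dS vd]|->//].
exact: (ST_eq SH dS cS vd vc).
Qed.

Lemma calpha_composition S c : S \in ST H -> c \in S -> is_composition #|cverts c| (calpha c).
Proof. by move=> SH /(ST_is_ctriple SH)/and3P[]. Qed.

(** Only the triple of the first vertex loses a part, namely its head, which is the value that [rem]
    deletes from the sorted concatenation. *)
Lemma perm_reduced_type S : S \in ST H ->
  perm_eq (reduced_type S) (flatten [seq reduced_alpha c | c <- enum S]).
Proof.
move=> SH; have [c0 c0S v0] := ST_cover SH ord0.
have c0E c : c \in S -> (ord0 \in cverts c) = (c == c0).
  by move=> cS; apply/idP/eqP => [vc|->//]; exact: (ST_eq SH cS c0S vc v0).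
have alphaE : alpha_at S ord0 = calpha c0.
  rewrite /alpha_at; case: pickP => [c /andP[cS]|/(_ c0)]; last by rewrite c0S v0.
  by rewrite c0E// => /eqP ->.
(* The component contains [ord0], so its composition is nonempty and [head] returns a true part. *)
have [h [al calE]] : exists h al, calpha c0 = h :: al.
  have := calpha_composition SH c0S; case: (calpha c0) => [|h al]; last by exists h, al.
  by rewrite /is_composition /= => /eqP/esym/cards0_eq c00; rewrite c00 inE in v0.
rewrite /reduced_type alphaE calE /= -(perm_cons h).
apply: (perm_trans (y := st_type S)).
  rewrite perm_sym perm_to_rem// mem_sort; apply/flatten_mapP; exists c0.
    by rewrite mem_enum.
  by rewrite calE mem_head.
rewrite perm_sort; apply/permP => a /=; rewrite !count_flatten_enum.
rewrite (bigD1 c0)//= [X in _ = (_ + X)%N](bigD1 c0)//= addnA; congr addn.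
  by rewrite /reduced_alpha v0 calE.
apply: eq_bigr => c /andP[cS cc0]; rewrite /reduced_alpha c0E//.
by rewrite (negPf cc0).
Qed.

(** The vertex sets partition the graph, so the exponent of the sign is the sum of the local
    exponents. *)
Lemma prod_triple_weight S : S \in ST H ->
  (-1) ^+ (n.+1 - size (st_type S)) * \prod_(i <- reduced_type S) e i =
  \prod_(c in S) triple_weight c.
Proof.
move=> SH; rewrite big_split /= (perm_big _ (perm_reduced_type SH)) big_flatten big_map.
rewrite big_enum /=; congr (_ * _); rewrite -expr_sum; congr (_ ^+ _).
rewrite size_sort -count_predT count_flatten_enum -[X in (X - _)%N](sum_cverts SH).
rewrite -sumnB => [|c cS]; last first.
  by rewrite count_predT (composition_size (calpha_composition SH cS)).
by apply: eq_bigr => c _; rewrite count_predT.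
Qed.

End Weights.

(** * Extending an edge set of G by the path *)

Section SumPath.
Variables (n q : nat) (G : sgraph n.+1).
Let V := 'I_n.+1.
Let V' := 'I_(n + q).+1.
Let H : sgraph (n + q).+1 := sum_path G q.+1.
Implicit Types (F : {set {set V}}) (W e : {set V}).

(** Retraction of the sum onto [G]: the whole path goes to the last vertex of [G]. *)
Definition collapse (v : V') : V := inord (minn v n).
Definition extend : V -> V' := sum_embl q (n := n).
Definition path_edge (i : 'I_q) : {set V'} := [set inord (n + i); inord (n + i).+1].
Definition path_part : {set {set V'}} := [set path_edge i | i : 'I_q].
Definition extend_edges F : {set {set V'}} := [set extend @: e | e : {set V} in F] :|: path_part.

Lemma val_extend v : extend v = v :> nat.
Proof. by rewrite inordK//; have := ltn_ord v; lia. Qed.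

Lemma val_collapse v : collapse v = minn v n :> nat.
Proof. by rewrite inordK//; lia. Qed.

Lemma extend_inj : injective extend.
Proof. by move=> u v /(congr1 val); rewrite /= !val_extend => /val_inj. Qed.

Lemma extendK : cancel extend collapse.
Proof. by move=> v; apply: val_inj; rewrite /= val_collapse val_extend; have := ltn_ord v; lia. Qed.

Lemma edges_sum_path : edges H = extend_edges (edges G).
Proof.
congr (_ :|: _); apply/setP => e'; apply/imsetP/imsetP => [[e /imsetP[[a b] + ->] ->]|[i _ ->]].
  rewrite inE /= => /eqP ab; have ltaq : (a < q)%N by have := ltn_ord b; rewrite /= in ab *; lia.
  exists (Ordinal ltaq) => //; rewrite imsetU1 imset_set1 /sum_embr /path_edge /=.
  by rewrite ab addnS.
have ltiq := ltn_ord i; pose a : 'I_q.+1 := inord i; pose b : 'I_q.+1 := inord i.+1.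
exists [set a; b]; last first.
  by rewrite imsetU1 imset_set1 /sum_embr /path_edge !inordK ?addnS//; lia.
by apply/imsetP; exists (a, b); rewrite // inE /= !inordK//; lia.
Qed.

Lemma mem_path_edge (i : 'I_q) (v : V') :
  (v \in path_edge i) = (v == n + i :> nat)%N || (v == (n + i).+1 :> nat)%N.
Proof. by rewrite !inE -!val_eqE /= !inordK//; have := ltn_ord i; lia. Qed.

Lemma path_edge_inj : injective path_edge.
Proof.
move=> i j eq_ij; apply: val_inj => /=.
have : inord (n + i) \in path_edge j by rewrite -eq_ij !inE eqxx.
have : inord (n + i).+1 \in path_edge j by rewrite -eq_ij !inE eqxx orbT.
rewrite !mem_path_edge !inordK; have := ltn_ord i; lia.
Qed.

Lemma extend_path e : extend @: e \notin path_part.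
Proof.
apply/imsetP => -[i _ eE]; have : inord (n + i).+1 \in extend @: e by rewrite eE !inE eqxx orbT.
case/imsetP => v _ /(congr1 val); rewrite /= val_extend inordK.
  by have := ltn_ord v; lia.
by have := ltn_ord i; lia.
Qed.

Lemma card_extend_edges F : #|extend_edges F| = (#|F| + q)%N.
Proof.
rewrite cardsU (_ : _ :&: _ = finset.set0) ?cards0 ?subn0.
  by rewrite !card_imset ?card_ord//; [exact: path_edge_inj | exact/imset_inj/extend_inj].
apply/setP => e'; rewrite !inE; apply/andP => -[/imsetP[e _ ->]].
exact/negP/extend_path.
Qed.

Lemma adjacent_extend F u v : adjacent (extend_edges F) u v ->
  collapse u = collapse v \/ adjacent F (collapse u) (collapse v).
Proof.
rewrite /adjacent => /setUP[/imsetP[e eF uve]|/imsetP[i _ uvi]].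
  right; suff -> : [set collapse u; collapse v] = e by [].
  apply: (imset_inj extend_inj); rewrite -uve imsetU1 imset_set1.
  suff ext x : x \in [set u; v] -> extend (collapse x) = x.
    by rewrite !ext ?inE ?eqxx ?orbT.
  by rewrite uve => /imsetP[y _ ->]; rewrite extendK.
left; apply: val_inj; rewrite /= !val_collapse.
have : u \in path_edge i by rewrite -uvi !inE eqxx.
have : v \in path_edge i by rewrite -uvi !inE eqxx orbT.
rewrite !mem_path_edge; lia.
Qed.

Lemma connect_path (F' : {set {set V'}}) (v : V') : path_part \subset F' -> (n <= v)%N ->
  connect (adjacent F') (inord n) v.
Proof.
move=> /subsetP pF' le_nv; rewrite -[v]inord_val; have := ltn_ord v.
have [i ->] : exists i, val v = (n + i)%N by exists (v - n)%N; rewrite /= subnKC.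
elim: i => [|i IH] lt_iq; first by rewrite addn0 connect0.
apply: connect_trans (IH _) _; first by lia.
have ltiq : (i < q)%N by lia.
by apply/connect1/pF'/imsetP; exists (Ordinal ltiq); rewrite // /path_edge /= addnS.
Qed.

Lemma extend_max : extend ord_max = inord n.
Proof. by []. Qed.

Lemma connect_extend_collapse F v : connect (adjacent (extend_edges F)) (extend (collapse v)) v.
Proof.
have [le_nv|lt_vn] := leqP n v.
  rewrite (_ : collapse v = ord_max); last by apply: val_inj; rewrite /= val_collapse; lia.
  by rewrite extend_max connect_path// finset.subsetUr.
rewrite (_ : extend _ = v) ?connect0//; apply: val_inj.
by rewrite /= val_extend val_collapse; lia.
Qed.

(** [collapse] contracts the path edges and maps the other ones to edges of [F]; conversely, each
    [v] is joined to [extend (collapse v)] along the path. *)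
Lemma connect_extend_edges F u v :
  connect (adjacent (extend_edges F)) u v = connect (adjacent F) (collapse u) (collapse v).
Proof.
apply/idP/idP => uv.
  suff : v \in [set x | connect (adjacent F) (collapse u) (collapse x)] by rewrite inE.
  apply: connect_invariant uv _; last by rewrite inE.
  move=> x y; rewrite !inE => ux /adjacent_extend[<-//|xy].
  exact: connect_trans ux (connect1 xy).
apply: (connect_trans (y := extend (collapse u))).
  by rewrite adjacent_connect_sym connect_extend_collapse.
apply: connect_trans (connect_extend_collapse F v).
suff : collapse v \in
    [set x | connect (adjacent (extend_edges F)) (extend (collapse u)) (extend x)].
  by rewrite inE.
apply: connect_invariant uv _; last by rewrite inE.
move=> x y; rewrite !inE => ux xy; apply: connect_trans ux (connect1 _).
rewrite /adjacent inE; apply/orP; left; apply/imsetP; exists [set x; y] => //.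
by rewrite imsetU1 imset_set1.
Qed.

Lemma component_extend F v :
  component (extend_edges F) v = collapse @^-1: component F (collapse v).
Proof. by apply/setP => u; rewrite !inE connect_extend_edges. Qed.

Lemma collapse_preimset_inj : injective (fun W => collapse @^-1: W).
Proof.
by move=> W W' /setP WW'; apply/setP => v; have := WW' (extend v); rewrite !inE extendK.
Qed.

Lemma components_extend F :
  components (extend_edges F) = [set collapse @^-1: W | W : {set V} in components F].
Proof.
apply/setP => W'; apply/imsetP/imsetP => [[v _ ->]|[_ /imsetP[v _ ->] ->]].
  by rewrite component_extend; exists (component F (collapse v)); rewrite ?component_components.
by exists (extend v); rewrite ?inE// component_extend extendK.
Qed.

Lemma card_collapse_preimset W :
  #|collapse @^-1: W| = (#|W| + if ord_max \in W then q else 0)%N.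
Proof.
rewrite -!sum1_card big_mkcond /= (@big_split_ord _ _ _ n.+1 q) /=; congr addn.
  rewrite -big_mkcond /=; apply: eq_bigl => v; rewrite inE.
  suff -> : collapse (lshift q v) = v by [].
  by apply: val_inj; rewrite /= val_collapse /=; have := ltn_ord v; lia.
rewrite (eq_bigr (fun _ => nat_of_bool (ord_max \in W))) ?sum_nat_const ?card_ord.
  by case: ifP; rewrite ?muln1 ?muln0.
move=> i _; rewrite inE (_ : collapse _ = ord_max); first by case: ifP.
by apply: val_inj; rewrite /= val_collapse /=; lia.
Qed.

(** Without [path_edge i], no edge leaves the set of vertices of value at most [n + i], so the end
    of the path is cut off from its start. *)
Lemma path_part_sub (F' : {set {set V'}}) : F' \subset edges H ->
  [set v : V' | (n <= v)%N] \subset component F' (inord n) -> path_part \subset F'.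
Proof.
move=> F'H /subsetP pc; apply/subsetP => _ /imsetP[i _ ->]; apply/negPn/negP => niF'.
have lt_iq := ltn_ord i.
have : ord_max \in component F' (inord n) by apply: pc; rewrite inE /=; lia.
rewrite inE => nmax; suff : ord_max \in [set v : V' | (v <= n + i)%N] by rewrite inE /=; lia.
apply: connect_invariant nmax _; last by rewrite inE inordK; lia.
move=> x y; rewrite !inE => xi xy; rewrite leqNgt; apply/negP => lt_iy.
have := subsetP F'H _ xy; rewrite edges_sum_path => /setUP[/imsetP[e _ xye]|/imsetP[j _ xyj]].
  have : y \in extend @: e by rewrite -xye !inE eqxx orbT.
  by case/imsetP => z _ yz; rewrite yz val_extend in lt_iy; have := ltn_ord z; lia.
have : x \in path_edge j by rewrite -xyj !inE eqxx.
have : y \in path_edge j by rewrite -xyj !inE eqxx orbT.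
rewrite !mem_path_edge => yj xj; case/negP: niF'; suff <- : j = i by rewrite -xyj.
by apply: val_inj => /=; lia.
Qed.

Lemma sum_extend_edges (R : nmodType) (A : {set {set V'}} -> R) :
  (forall F' : {set {set V'}}, F' \subset edges H -> ~~ (path_part \subset F') -> A F' = 0) ->
  \sum_(F' : {set {set V'}} | F' \subset edges H) A F' =
  \sum_(F : {set {set V}} | F \subset edges G) A (extend_edges F).
Proof.
rewrite edges_sum_path => A0.
rewrite (bigID (fun F' : {set {set V'}} => path_part \subset F')) /=.
rewrite [X in _ + X]big1 ?addr0; last first.
  by move=> F' /andP[]; exact: A0.
pose res (F' : {set {set V'}}) : {set {set V}} := [set e in edges G | extend @: e \in F'].
rewrite (reindex_onto extend_edges res) => [|F' /andP[F'H pF']]; last first.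
  apply/setP => e'; apply/setUP/idP => [[/imsetP[e + ->]|/(subsetP pF')//]|e'F'].
    by rewrite inE => /andP[].
  have /setUP[/imsetP[e eG e'E]|] := subsetP F'H _ e'F'; last by right.
  by left; apply/imsetP; exists e; rewrite // inE eG -e'E.
have ext_inj := imset_inj extend_inj.
have mem_ext F e : (extend @: e \in extend_edges F) = (e \in F).
  by rewrite inE (negPf (extend_path e)) orbF mem_imset.
apply: eq_bigl => F; rewrite finset.subsetUr andbT.
apply/andP/idP => [[_ /eqP <-]|FG].
  by apply/subsetP => e; rewrite inE => /andP[].
split; first by rewrite finset.setSU// imsetS.
apply/eqP/setP => e; rewrite inE mem_ext andb_idl//; exact: subsetP.
Qed.

(** The conditions defining [STi], imposed on each triple separately as [sum_ST] requires; [STiE]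
    holds because exactly one triple contains a given vertex. *)
Definition entry_condition (c : ctriple (n + q).+1) : bool :=
  ((ord0 \in cverts c) ==> (head 0%N (calpha c) == q.+1) && (cr c == 1%N)) &&
  ((inord n \in cverts c) ==>
     ([set v : V' | (n <= v)%N] \subset cverts c) && (q < last 0%N (calpha c))%N).

Lemma STiE (S : {set ctriple (n + q).+1}) :
  (S \in STi G q.+1 q.+1) = (S \in ST H) && [forall c in S, entry_condition c].
Proof.
rewrite inE; apply: andb_id2l => SH; apply/exists_inP/forall_inP => [[c cS]|Sok].
  move=> /exists_inP[c' c'S /and5P[c0 cn hc rc /andP[pc lc]]] d dS; apply/andP; split.
    by apply/implyP => d0; rewrite (ST_eq SH dS cS d0 c0) hc rc.
  by apply/implyP => dn; rewrite (ST_eq SH dS c'S dn cn) pc lc.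
have [c cS c0] := ST_cover SH ord0; have [c' c'S cn] := ST_cover SH (inord n).
exists c => //; apply/exists_inP; exists c' => //.
have /andP[/implyP/(_ c0)/andP[-> ->] _] := Sok c cS.
by have /andP[_ /implyP/(_ cn)/andP[-> ->]] := Sok c' c'S; rewrite c0 cn.
Qed.

Variables (R : comNzRingType) (e : nat -> R) (t : R).

Lemma sum_triples (F' : {set {set V'}}) (W : {set V'}) :
  F' \subset edges H -> W \in components F' ->
  [set v : V' | (n <= v)%N] \subset component F' (inord n) ->
  \sum_(d | is_ctriple H (triple F' W d) && entry_condition (triple F' W d))
     triple_weight e (triple F' W d) =
  component_sum e (ord0 \in W) (inord n \in W) q #|W|.
Proof.
move=> F'H WF' pW; have leW : (#|W| <= (n + q).+1)%N.
  by rewrite -[X in (_ <= X)%N]card_ord max_card.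
rewrite -(sum_data _ _ _ _ leW); apply: eq_big => [d|d _]; last first.
  by rewrite /triple_weight /reduced_alpha.
rewrite /is_ctriple /cverts /cedges /= (connected_component F'H WF') /=.
rewrite /entry_condition /cverts /calpha /cr /=.
suff pn : inord n \in W -> [set v : V' | (n <= v)%N] \subset W.
  by rewrite -andbA; case: (boolP (inord n \in W)) => [/pn ->|_].
by rewrite (componentsP _ WF') => /eqP <-.
Qed.

Lemma sum_STi :
  \sum_(S in STi G q.+1 q.+1) (-1) ^+ ((n + q).+1 - size (st_type S)) * (-1) ^+ q *
    t ^+ (st_edges S + 1 - q.+1) * \prod_(i <- reduced_type S) e i =
  \sum_(F : {set {set V}} | F \subset edges G) t ^+ #|F| * ((-1) ^+ q *
    \prod_(W in components F) component_sum e (ord0 \in W) (ord_max \in W) q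
      (#|W| + if ord_max \in W then q else 0)).
Proof.
transitivity (\sum_(S in ST H | [forall c in S, entry_condition c])
    ((-1) ^+ q * t ^+ (st_edges S + 1 - q.+1)) * \prod_(c in S) triple_weight e c).
  apply: eq_big => [S|S]; first exact: STiE.
  rewrite STiE => /andP[SH _]; rewrite -(prod_triple_weight e SH).
  by rewrite [RHS]mulrACA -mulrA; congr (_ * _); exact: mulrC.
rewrite (sum_ST H entry_condition (fun m => (-1) ^+ q * t ^+ (m + 1 - q.+1))).
rewrite sum_extend_edges => [|F' F'H npF']; last first.
  (* Without the whole path the component of [inord n] admits no data, and its empty sum annihilates
     the product. *)
  rewrite (bigD1 (component F' (inord n))) ?component_components//= big_pred0 ?mul0r ?mulr0//.
  move=> d; apply/negP => /andP[_ /andP[_]].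
  rewrite /cverts /= component_id /= => /andP[pc _].
  by case/negP: npF'; exact: path_part_sub F'H pc.
apply: eq_bigr => F FG; rewrite card_extend_edges.
(* The [q] path edges cancel the shift of the exponent of [t]. *)
rewrite (_ : #|F| + q + 1 - q.+1 = #|F|)%N; last by lia.
rewrite mulrA [t ^+ _ * _]mulrC; congr (_ * _).
have FH : extend_edges F \subset edges H by rewrite edges_sum_path finset.setSU ?imsetS.
have path_comp : [set v : V' | (n <= v)%N] \subset component (extend_edges F) (inord n).
  by apply/subsetP => v; rewrite !inE; apply: connect_path; exact: finset.subsetUr.
rewrite [LHS](eq_bigr (fun W' : {set V'} =>
  component_sum e (ord0 \in W') (inord n \in W') q #|W'|)); last first.
  by move=> W' WF'; exact: sum_triples.
rewrite components_extend big_imset /=; last by move=> W W' _ _; exact: collapse_preimset_inj.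
apply: eq_bigr => W WF; rewrite card_collapse_preimset !inE.
by congr component_sum; congr (_ \in W); apply: val_inj; rewrite /= val_collapse /= ?inordK; lia.
Qed.

End SumPath.

(** * Identifying the first and the last vertex *)

Section AddEdge.
Variables (V : finType) (F : {set {set V}}) (a b : V).

Let U := component F a :|: component F b.
(** Colorings of the glued graph are those of [G] with equal colors at both ends, which the
    additional edge enforces. *)
Let Fab : {set {set V}} := [set a; b] |: F.

Lemma adjacent_add_edge u v : adjacent Fab u v -> u \in U -> v \in U.
Proof.
rewrite /adjacent => /setU1P[/setP uvE _|uv].
  have := uvE v; rewrite !inE eqxx orbT => /esym/orP[]/eqP ->; by rewrite connect0 ?orbT.
by rewrite !inE => /orP[] ux; apply/orP; [left|right]; exact: connect_trans ux (connect1 uv).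
Qed.

Lemma connect_add_edge u v : connect (adjacent F) u v -> connect (adjacent Fab) u v.
Proof.
apply: connect_sub => x y xy; apply: connect1.
by rewrite /adjacent inE; apply/orP; right.
Qed.

Lemma component_add_edge v : component Fab v = if v \in U then U else component F v.
Proof.
apply/setP => u; case: (boolP (v \in U)) => vU; apply/idP/idP.
- by rewrite inE => vu; apply: connect_invariant vu vU => x y xU /adjacent_add_edge; apply.
- move=> uU; rewrite inE.
  have aU x : x \in U -> connect (adjacent Fab) a x.
    rewrite !inE => /orP[/connect_add_edge//|/connect_add_edge bx].
    by apply: connect_trans (connect1 _) bx; apply: setU11.
  by apply: connect_trans (aU _ uU); rewrite adjacent_connect_sym aU.
- rewrite inE => vu; apply: connect_invariant vu (component_id F v) => x y xv.
  rewrite /adjacent => /setU1P[/setP xyE|xy]; last first.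
    by move: xv; rewrite !inE => vx; exact: connect_trans vx (connect1 xy).
  case/negP: vU; move: xv; rewrite !inE ![connect _ _ v]adjacent_connect_sym.
  have := xyE x; rewrite !inE eqxx => /esym/orP[]/eqP -> ->; by rewrite ?orbT.
- by rewrite !inE => /connect_add_edge.
Qed.

Lemma components_add_edge :
  components Fab = U |: [set W in components F | (a \notin W) && (b \notin W)].
Proof.
have nU v : (v \notin U) = (a \notin component F v) && (b \notin component F v).
  by rewrite !inE negb_or ![connect _ v _]adjacent_connect_sym.
apply/setP => W; apply/imsetP/setU1P => [[v _ ->]|[->|]].
- rewrite component_add_edge; case: ifPn => vU; [by left|right].
  by rewrite inE component_components -nU.
- by exists a => //; rewrite component_add_edge !inE connect0.
- rewrite inE => /andP[/imsetP[v _ ->]]; rewrite -nU => vU; exists v => //.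
  by rewrite component_add_edge (negPf vU).
Qed.

Lemma prod_components_add_edge (R : comNzRingType) (g : {set V} -> R) :
  \prod_(W in components Fab) g W =
  g U * \prod_(W in components F | (a \notin W) && (b \notin W)) g W.
Proof.
rewrite components_add_edge big_setU1 /=; last first.
  by rewrite !inE connect0 andbF.
by congr (_ * _); apply: eq_bigl => W; rewrite inE.
Qed.

Lemma prod_components_ends (R : comNzRingType) (g : {set V} -> R) :
  \prod_(W in components F) g W =
  (if component F a == component F b then g (component F a)
   else g (component F a) * g (component F b)) *
  \prod_(W in components F | (a \notin W) && (b \notin W)) g W.
Proof.
have memc v W : W \in components F -> (v \in W) = (W == component F v).
  by move=> WF; rewrite (componentsP _ WF) eq_sym.
have AF := component_components F a; have BF := component_components F b.
case: eqP => [AB|/eqP AB].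
  rewrite (bigD1 _ AF) /=; congr (_ * _); apply: eq_bigl => W.
  by apply: andb_id2l => WF; rewrite !memc// -AB andbb.
rewrite (bigD1 _ AF) (bigD1 (component F b)) /=; last by apply/andP; split; rewrite 1?eq_sym.
rewrite mulrA; congr (_ * _); apply: eq_bigl => W; rewrite -andbA.
by apply: andb_id2l => WF; rewrite !memc.
Qed.

End AddEdge.

(** * The sum over the diagonal for a fixed edge set *)

Section SumOverPathLength.
Variables (n : nat) (R : comNzRingType) (e : nat -> R) (F : {set {set 'I_n.+2}}).
Let a : 'I_n.+2 := ord0.
Let b : 'I_n.+2 := ord_max.
Let U := component F a :|: component F b.

(** Components avoiding both ends give the same factor for every [q]; the rest is
    [sum_component_sum_tt] or [sum_component_sum_tf_ft], according to whether the ends share a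
    component. *)
Lemma sum_prod_component_sum :
  \sum_(q < n.+1) (-1) ^+ q * \prod_(W in components F)
     component_sum e (a \in W) (b \in W) q (#|W| + if b \in W then nat_of_ord q else 0) =
  psum e #|U|.-1 * \prod_(W in components F | (a \notin W) && (b \notin W)) psum e #|W|.
Proof.
pose A := component F a; pose B := component F b.
pose g (q : nat) (W : {set 'I_n.+2}) :=
  component_sum e (a \in W) (b \in W) q (#|W| + if b \in W then q else 0).
have AF : A \in components F by exact: component_components.
have BF : B \in components F by exact: component_components.
have inA W : W \in components F -> (a \in W) = (W == A).
  by move=> WF; rewrite (componentsP _ WF) eq_sym.
have inB W : W \in components F -> (b \in W) = (W == B).
  by move=> WF; rewrite (componentsP _ WF) eq_sym.
have others q : \prod_(W in components F | (a \notin W) && (b \notin W)) g q W =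
    \prod_(W in components F | (a \notin W) && (b \notin W)) psum e #|W|.
  apply: eq_bigr => W /andP[_ /andP[/negPf aW /negPf bW]].
  by rewrite /g aW bW component_sum_ff addn0.
have cA : (0 < #|A|)%N by apply/card_gt0P; exists a; exact: component_id.
have cB : (0 < #|B|)%N by apply/card_gt0P; exists b; exact: component_id.
have ab : a != b by [].
rewrite -[LHS]/(\sum_(q < n.+1) (-1) ^+ q * \prod_(W in components F) g q W).
have [AB|AB] := eqVneq A B.
  have cU : U = A by rewrite /U -/A -/B -AB finset.setUid.
  transitivity (\sum_(q < n.+1) (-1) ^+ q * component_sum e true true q (#|A|.-1.+1 + q) *
     \prod_(W in components F | (a \notin W) && (b \notin W)) psum e #|W|).
    apply: eq_bigr => q _; rewrite (prod_components_ends F a b (g q)) -/A -/B.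
    rewrite -AB eqxx (others q) mulrA.
    by rewrite /g inA// inB// -AB eqxx prednK.
  rewrite -big_distrl sum_component_sum_tt ?cU//.
  (* [#|A|.-1] must be positive: [A] contains the two distinct ends. *)
  have : (#|[set a; b]| <= #|A|)%N.
    apply/subset_leq_card/subsetP => x; rewrite finset.in_set2 => /orP[]/eqP ->.
      exact: component_id.
    by rewrite inB// AB.
  have := max_card A; rewrite cards2 ab card_ord; lia.
have dAB : [disjoint A & B].
  rewrite -setI_eq0; apply/eqP/setP => v; rewrite finset.in_set0; apply/negP => /setIP[vA vB].
  by case/eqP: AB; exact: components_eq AF BF vA vB.
have cU : #|U| = (#|A| + #|B|)%N.
  by move: dAB; rewrite -setI_eq0 cardsU => /eqP ->; rewrite cards0 subn0.
transitivity (\sum_(q < n.+1) (-1) ^+ q * component_sum e true false q #|A| *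
    component_sum e false true q (#|B| + q) *
    \prod_(W in components F | (a \notin W) && (b \notin W)) psum e #|W|).
  apply: eq_bigr => q _; rewrite (prod_components_ends F a b (g q)) -/A -/B.
  rewrite (negPf AB) (others q) !mulrA.
  by rewrite /g inA// !inB// inA// !eqxx [B == A]eq_sym (negPf AB) addn0.
rewrite -big_distrl sum_component_sum_tf_ft ?cU//; rewrite cA /=.
(* The range [q < n.+1] is long enough, since [B] takes at least one of the [n.+2] vertices. *)
have := max_card U; rewrite cU card_ord; move: cB; move: #|A| #|B| => x y; lia.
Qed.

End SumOverPathLength.

(** * Colorings of the glued graph *)

Lemma sum_subsets_exp (R : comNzRingType) (T : finType) (A : {set T}) (t : R) :
  (1 + t) ^+ #|A| = \sum_(F : {set T} | F \subset A) t ^+ #|F|.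
Proof.
transitivity (\prod_(i : T) ((if i \in A then t else 0) + 1)).
  rewrite -prodr_const big_mkcond; apply: eq_bigr => i _.
  by case: ifP; rewrite ?add0r// addrC.
rewrite bigA_distr [RHS]big_mkcond /=; apply: eq_bigr => F _.
case: ifPn => [/subsetP FA|/subsetPn[i iF niA]]; last first.
  by rewrite (bigD1 i)//= iF (negPf niA) mul0r.
rewrite -prodr_const [RHS]big_mkcond; apply: eq_bigr => i _.
by case: ifP => // /FA ->.
Qed.

Section Colorings.
Variables (n B : nat) (G : sgraph n.+2).
Let I := 'I_B.+1.

Definition pullback (kappa : {ffun 'I_n.+1 -> I}) : {ffun 'I_n.+2 -> I} :=
  [ffun v => kappa (glue_vertex v)].

Definition nat_coloring (kappa : {ffun 'I_n.+1 -> I}) : {ffun 'I_n.+1 -> nat} :=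
  [ffun v => val (kappa v)].

Lemma glue_vertex_lift (v : 'I_n.+1) : glue_vertex (lift ord_max v) = v.
Proof. by rewrite /glue_vertex liftK. Qed.

Lemma glue_vertex_max : glue_vertex (ord_max : 'I_n.+2) = ord0.
Proof. by rewrite /glue_vertex unlift_none. Qed.

Lemma lift_max_widen (v : 'I_n.+1) : lift ord_max v = widen_ord (leqnSn n.+1) v.
Proof. by apply: val_inj; rewrite /= /bump leqNgt ltn_ord. Qed.

(** Each edge of [G] gives one entry of the multiset, so counting with multiplicity is counting
    edges of [G]; an edge joining the two ends becomes a loop and is monochromatic on both sides. *)
Lemma num_mono_glue (kappa : {ffun 'I_n.+1 -> I}) :
  num_mono (glue G) (nat_coloring kappa) =
  #|[set e in edges G | monochromatic [set e] (pullback kappa)]|.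
Proof.
rewrite /num_mono (permP (perm_eq_seq_mset _)) count_map -sum1_count big_enum_cond /=.
rewrite sum1dep_card; apply: eq_card => e; rewrite !inE; apply: andb_id2l => eG.
apply/forall_inP/forall_inP => [me f /set1P ->|me u' /imsetP[u ue ->]].
  apply/forall_inP => u ue; apply/forall_inP => v ve; rewrite !ffunE.
  have := forall_inP (me _ (imset_f _ ue)) _ (imset_f _ ve).
  by rewrite !ffunE val_eqE.
apply/forall_inP => v' /imsetP[v ve ->]; rewrite !ffunE val_eqE.
by have := forall_inP (forall_inP (me _ (set11 e)) _ ue) _ ve; rewrite !ffunE.
Qed.

Variables (R : comNzRingType) (x : nat -> R) (t : R).

Let a : 'I_n.+2 := ord0.
Let b : 'I_n.+2 := ord_max.

(** The bijection repeats the color of the first vertex at the last one; the weight 1 at [b] makes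
    the merged vertex count once. *)
Lemma sum_pullback (F : {set {set 'I_n.+2}}) :
  \sum_(kappa : {ffun 'I_n.+1 -> I} | monochromatic F (pullback kappa)) \prod_v x (kappa v) =
  \sum_(kappa : {ffun 'I_n.+2 -> I} | monochromatic ([set a; b] |: F) kappa)
     \prod_v (if v == b then 1 else x (kappa v)).
Proof.
pose res (kappa : {ffun 'I_n.+2 -> I}) : {ffun 'I_n.+1 -> I} :=
  [ffun v => kappa (lift ord_max v)].
have monoab (kappa : {ffun 'I_n.+2 -> I}) :
    monochromatic ([set a; b] |: F) kappa = (kappa a == kappa b) && monochromatic F kappa.
  apply/forall_inP/andP => [mab|[/eqP kab mF] e /setU1P[->|eF]].
  - split; last by apply/forall_inP => e eF; apply: mab; rewrite inE eF orbT.
    exact: (forall_inP (forall_inP (mab _ (setU11 _ _)) a (set21 _ _)) b (set22 _ _)).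
  - apply/forall_inP => u uab; apply/forall_inP => v vab; move: uab vab.
    by move=> /set2P[]-> /set2P[]->; rewrite ?kab.
  - exact: (forall_inP mF).
rewrite [RHS](reindex_onto pullback res) => [|kappa]; last first.
  rewrite monoab => /andP[/eqP kab _]; apply/ffunP => v; rewrite !ffunE.
  case: (unliftP ord_max v) => [w ->|->]; first by rewrite glue_vertex_lift.
  rewrite glue_vertex_max -[RHS]kab; congr (kappa _); exact: val_inj.
apply: eq_big => [kappa|kappa _].
  rewrite monoab !ffunE glue_vertex_max.
  rewrite (_ : glue_vertex a = ord0) ?eqxx /=; last first.
    by rewrite -[RHS]glue_vertex_lift; congr glue_vertex; exact: val_inj.
  rewrite (_ : res _ == _) ?andbT//; apply/eqP/ffunP => v.
  by rewrite !ffunE glue_vertex_lift.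
rewrite [RHS]big_ord_recr /= eqxx mulr1; apply: eq_bigr => v _.
rewrite -lift_max_widen eq_sym (negPf (neq_lift _ _)) ffunE glue_vertex_lift//.
Qed.

(** The merged component contains [b], which has weight 1; hence the predecessor in the degree of
    its power sum. *)
Lemma sum_pullback_power_sum (F : {set {set 'I_n.+2}}) : F \subset edges G ->
  \sum_(kappa : {ffun 'I_n.+1 -> I} | monochromatic F (pullback kappa)) \prod_v x (kappa v) =
  power_sum x B.+1 #|component F a :|: component F b|.-1 *
    \prod_(W in components F | (a \notin W) && (b \notin W)) power_sum x B.+1 #|W|.
Proof.
move=> FG; rewrite sum_pullback.
rewrite (sum_monochromatic ord0 (fun v i => if v == b then 1 else x (nat_of_ord i))); last first.
  by move=> e /setU1P[->|/(edges_eq2 FG)//]; rewrite cards2.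
rewrite prod_components_add_edge /power_sum; congr (_ * _).
  apply: eq_bigr => i _; have bU : b \in component F a :|: component F b.
    by rewrite inE component_id orbT.
  rewrite (bigD1 b bU) /= eqxx mul1r (eq_bigr (fun _ => x i)); last first.
    by move=> v /andP[_ /negPf ->].
  rewrite (cardsD1 b) bU /= -prodr_const; apply: eq_bigl => v.
  by rewrite in_setD1 andbC.
apply: eq_bigr => W /andP[_ /andP[_ bW]]; apply: eq_bigr => i _.
rewrite -prodr_const; apply: eq_bigr => v vW; case: eqP => // vb.
by rewrite vb (negPf bW) in vW.
Qed.

(** The trace formula in [B.+1] variables over any commutative ring: both sides become sums over the
    subsets [F] of [edges G], which agree term by term through power sums. *)
Lemma sum_colorings :
  \sum_(kappa : {ffun 'I_n.+1 -> I})
     (1 + t) ^+ num_mono (glue G) (nat_coloring kappa) * \prod_v x (kappa v) =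
  \sum_(q < n.+1) \sum_(S in STi G q.+1 q.+1)
     (-1) ^+ ((n.+1 + q).+1 - size (st_type S)) * (-1) ^+ q * t ^+ (st_edges S + 1 - q.+1) *
     \prod_(i <- reduced_type S) elem x B.+1 i.
Proof.
transitivity (\sum_(kappa : {ffun 'I_n.+1 -> I}) \sum_(F : {set {set 'I_n.+2}} |
    (F \subset edges G) && monochromatic F (pullback kappa)) t ^+ #|F| * \prod_v x (kappa v)).
  (* Expanding the power of [1 + t] gives a sum over the sets of monochromatic edges. *)
  apply: eq_bigr => kappa _; rewrite num_mono_glue sum_subsets_exp big_distrl /=.
  apply: eq_bigl => F; apply/subsetP/andP => [Fm|[/subsetP FG mF] e eF].
    split; first by apply/subsetP => e /Fm; rewrite inE => /andP[].
    apply/forall_inP => e /Fm; rewrite inE => /andP[_ /forall_inP]; apply; exact: set11.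
  rewrite inE FG//=; apply/forall_inP => _ /set1P ->; exact: (forall_inP mF).
rewrite (exchange_big_dep (fun F : {set {set 'I_n.+2}} => F \subset edges G)) /=;
  last by move=> kappa F _ /andP[].
under [RHS]eq_bigr do rewrite (sum_STi _ _ (elem x B.+1)).
rewrite [RHS]exchange_big /=; apply: eq_bigr => F FG; rewrite -!big_distrr /=; congr (_ * _).
rewrite (eq_bigl (fun kappa => monochromatic F (pullback kappa))) => [|kappa]; last by rewrite FG.
rewrite sum_pullback_power_sum// sum_prod_component_sum psum_power_sum; last first.
  (* The merged component contains both ends, so its degree is positive, as [psum_power_sum]
     requires. *)
  have : (#|[set a; b]| <= #|component F a :|: component F b|)%N.
    by apply/subset_leq_card/subsetP => v /set2P[]->; rewrite inE component_id ?orbT.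
  by rewrite cards2 /=; case: #|_| => // -[].
congr (_ * _); apply: eq_bigr => W /andP[WF _]; rewrite psum_power_sum//.
by have [v vW] := components_neq0 WF; apply/card_gt0P; exists v.
Qed.

End Colorings.

(** * Truncation to finitely many variables *)

Local Open Scope mset_scope.

Section Fps.
Variable R : comNzRingType.
Implicit Types (f g : fps R) (m u v : {mset nat}) (c : R).

Lemma fpsE f g : (forall m, f m = g m) -> f = g.
Proof. exact: funext. Qed.

Lemma fps_sumE (I : Type) (r : seq I) (P : pred I) (F : I -> fps R) m :
  (\sum_(i <- r | P i) F i) m = \sum_(i <- r | P i) F i m.
Proof. by elim/big_rec2: _ => // i a b _ <-. Qed.

Lemma fps_scalerAl c f g : c *: (f * g) = c *: f * g.
Proof.
apply: fpsE => m; have [s us sP] := submset_enum m; have mm := msubset_refl m.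
rewrite -[LHS]/(c * fps_mul f g m) -[RHS]/(fps_mul (c *: f) g m) !(fps_mulE _ _ us sP)//.
rewrite big_distrr; apply: eq_bigr => u _; rewrite big_distrr; apply: eq_bigr => v _ /=.
by case: ifP => _; rewrite ?mulr0// -[(c *: f) u]/(c * f u) mulrA.
Qed.

(** Constant series make the scalars, [t] among them, elements of the ring of series, in which
    [sum_colorings] is applied. *)
Definition fpsC c : fps R := c *: (1 : fps R).

Lemma fps_scaleE c f : c *: f = fpsC c * f.
Proof. by rewrite -fps_scalerAl mul1r. Qed.

Lemma fpsCD c d : fpsC (c + d) = fpsC c + fpsC d.
Proof. exact: scalerDl. Qed.

Lemma fpsCM c d : fpsC (c * d) = fpsC c * fpsC d.
Proof. by rewrite -fps_scaleE /fpsC scalerA. Qed.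

Lemma fpsC1 : fpsC 1 = 1.
Proof. exact: scale1r. Qed.

Lemma fpsCN c : fpsC (- c) = - fpsC c.
Proof. exact: scaleNr. Qed.

Lemma fpsCX c k : fpsC (c ^+ k) = fpsC c ^+ k.
Proof. by elim: k => [|k IH]; rewrite ?fpsC1// !exprS fpsCM IH. Qed.

Definition below (B : nat) m : bool := all (fun i => i < B)%N (enum_mset m).

Lemma belowP B m : reflect (forall i, i \in m -> (i < B)%N) (below B m).
Proof. exact: allP. Qed.

Lemma belowD B u v : below B (u `+` v) = below B u && below B v.
Proof.
apply/belowP/andP => [uv|[/belowP uB /belowP vB] i].
  by split; apply/belowP => i iu; apply: uv; rewrite in_msetD iu ?orbT.
by rewrite in_msetD => /orP[/uB|/vB].
Qed.

Lemma exists_below m : exists B, below B.+1 m.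
Proof.
exists (\max_(i <- enum_mset m) i)%N; apply/belowP => i im.
by rewrite ltnS; apply: (@leq_bigmax_seq _ _ predT id).
Qed.

(* The image of [f] when the variables of index at least [B] are set to 0. *)
Definition truncate (B : nat) f : fps R := fun m => if below B m then f m else 0.

(** A monomial involves finitely many variables, so some truncation retains it. The successor keeps
    the set of colors ['I_B.+1] nonempty. *)
Lemma truncate_eq f g : (forall B, truncate B.+1 f = truncate B.+1 g) -> f = g.
Proof.
move=> fg; apply: fpsE => m; have [B mB] := exists_below m.
by have := congr1 (fun h : fps R => h m) (fg B); rewrite /truncate mB.
Qed.

Section Truncate.
Variable B : nat.

Lemma truncateZ c f : truncate B (c *: f) = c *: truncate B f.
Proof.
apply: fpsE => m; rewrite -[RHS]/(c * truncate B f m) /truncate.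
by case: ifP; rewrite ?mulr0.
Qed.

Lemma truncate_sum (I : Type) (r : seq I) (P : pred I) (F : I -> fps R) :
  truncate B (\sum_(i <- r | P i) F i) = \sum_(i <- r | P i) truncate B (F i).
Proof.
apply: fpsE => m; rewrite fps_sumE /truncate fps_sumE; case: ifP => // _.
by rewrite big1.
Qed.

Lemma truncate1 : truncate B 1 = 1.
Proof.
apply: fpsE => m; rewrite /truncate; case: ifP => // mB.
rewrite -[RHS]/(fps_one R m) /fps_one; case: eqP => // m0; case/negP: mB.
by rewrite m0; apply/belowP => i; rewrite in_mset0.
Qed.

(** A product of monomials is below [B] exactly when both factors are. *)
Lemma truncateM f g : truncate B (f * g) = truncate B f * truncate B g.
Proof.
apply: fpsE => m; have [s us sP] := submset_enum m; have mm := msubset_refl m.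
rewrite /truncate -[(f * g) m]/(fps_mul f g m) -[RHS]/(fps_mul _ _ m) !(fps_mulE _ _ us sP)//.
transitivity (\sum_(u <- s) \sum_(v <- s)
    if u `+` v == m then if below B m then f u * g v else 0 else 0).
  case: ifP => // _; rewrite big1// => u _; rewrite big1// => v _.
  by rewrite if_same.
apply: eq_bigr => u _; apply: eq_bigr => v _; case: eqP => // <-.
by rewrite belowD; case: (below B u); case: (below B v); rewrite ?mulr0 ?mul0r.
Qed.

Lemma truncate_prod (I : Type) (r : seq I) (F : I -> fps R) :
  truncate B (\prod_(i <- r) F i) = \prod_(i <- r) truncate B (F i).
Proof. by elim/big_rec2: _ => [|i a b _ <-]; rewrite ?truncate1 ?truncateM. Qed.

End Truncate.

Definition monomial m : fps R := fun m' => (m' == m)%:R.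
Definition fpsX (i : nat) : fps R := monomial [mset i].

Lemma fpsXM i f m : (fpsX i * f) m = if i \in m then f (m `\ i) else 0.
Proof.
rewrite -[LHS]/(fps_mul (fpsX i) f m) /fps_mul /fps_sum.
rewrite (fsbigE (if i \in m then [:: ([mset i], m `\ i)] else [::])).
- case: ifP => im; rewrite ?big_nil// big_mkcond big_seq1 /= mem_set /=; last exact: msetB1K.
  by rewrite /fpsX /monomial eqxx mul1r.
- by case: ifP.
- by case: ifP => im p //=; rewrite inE => /eqP -> /=; exact: msetB1K.
move=> [u v] /= uv; rewrite /fpsX /monomial; case: eqP => [ui|]; last by rewrite mul0r.
by rewrite -uv ui mset1D1 msetD1K inE eqxx.
Qed.

Lemma fpsX_monomial i m : fpsX i * monomial m = monomial (i +` m).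
Proof.
apply: fpsE => m'; rewrite fpsXM /monomial; case: ifPn => im'.
  congr ((_ : bool)%:R); apply/eqP/eqP => [<-|->]; last exact: msetD1K.
  by rewrite msetB1K.
by case: eqP => // m'E; rewrite m'E mset1D1 in im'.
Qed.

Lemma seq_mset_cons (i : nat) s : seq_mset (i :: s) = i +` seq_mset s.
Proof.
by apply/msetP => j; rewrite mset1DE !mset_seqE /= eq_sym.
Qed.

Lemma prod_fpsX (s : seq nat) : \prod_(i <- s) fpsX i = monomial (seq_mset s).
Proof.
elim: s => [|i s IH]; last first.
  rewrite big_cons IH fpsX_monomial seq_mset_cons; reflexivity.
rewrite big_nil (_ : seq_mset [::] = mset0); first reflexivity.
by apply/msetP => j; rewrite mset0E mset_seqE.
Qed.

(** A multiset without repetition has exactly one strictly increasing listing, its sorted one; with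
    a repetition it has none. *)
Lemma esymE k m : Defs.esym R k m = ((size m == k) && uniq m)%:R.
Proof.
rewrite /Defs.esym /fps_sum; case: (boolP (_ && _)) => [/andP[/eqP sm um]|nmk].
  have st : size (sort leq m) == k by rewrite size_sort sm.
  have tm : seq_mset (Tuple st) = m.
    by rewrite -[RHS]seq_mset_id; apply/eq_seq_msetP; rewrite perm_sort.
  have stt : sorted ltn (Tuple st).
    by rewrite ltn_sorted_uniq_leq sort_uniq um sort_sorted//; exact: leq_total.
  rewrite (fsbigE [:: Tuple st])//.
  - by rewrite big_mkcond big_seq1 mem_set// stt.
  - by move=> t /=; rewrite inE => /eqP ->.
  move=> t /= tE; rewrite inE; case: (boolP (sorted ltn t)) => // tt /eqP[].
  apply: val_inj; apply: (@irr_sorted_eq _ ltn) => //; first exact: ltn_trans.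
    exact: ltnn.
  by apply/perm_mem/eq_seq_msetP; rewrite tE tm.
rewrite fsbig1// => t /= tE; case: (boolP (sorted ltn t)) => // tt; case/negP: nmk.
have pt : perm_eq m t by rewrite -tE perm_eq_seq_mset.
by rewrite (perm_size pt) size_tuple eqxx (perm_uniq pt) (sorted_uniq ltn_trans ltnn).
Qed.

Lemma mset_cons i m : i \in m -> perm_eq m (i :: enum_mset (m `\ i)).
Proof.
move=> im; rewrite -[X in perm_eq (enum_mset X)](msetB1K im).
rewrite -[X in i +` X]seq_mset_id -seq_mset_cons; exact: perm_eq_seq_mset.
Qed.

Lemma size_mset_eq0 m : (size m == 0)%N = (m == mset0).
Proof.
apply/eqP/eqP => [/size0nil m0|->]; last by rewrite enum_mset0.
apply/msetP => i; rewrite mset0E; apply/eqP; rewrite mset_eq0.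
by rewrite -[i \in m]/(i \in enum_mset m) m0.
Qed.

Lemma esym0 : Defs.esym R 0 = 1.
Proof.
apply: fpsE => m; rewrite esymE size_mset_eq0 -[RHS]/(fps_one R m) /fps_one.
by case: eqP => // ->; rewrite enum_mset0.
Qed.

(** The recursion of [elem]: a squarefree monomial below [B.+1] either avoids the variable [B] or
    contains it once, next to a monomial below [B]. *)
Lemma truncate_esym B k : truncate B (Defs.esym R k) = elem fpsX B k.
Proof.
elim: B k => [|B IH] [|k]; rewrite ?esym0 ?truncate1 ?elem0//.
  apply: fpsE => m; rewrite /truncate esymE -[RHS]/(0 : R) /below.
  by case: (enum_mset m).
rewrite -[elem _ _ _]/(elem fpsX B k.+1 + fpsX B * elem fpsX B k) -!IH.
apply: fpsE => m; rewrite -[RHS]/(truncate B (Defs.esym R k.+1) m +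
  (fpsX B * truncate B (Defs.esym R k)) m) fpsXM /truncate !esymE /below.
case: (boolP (B \in m)) => [Bm|nBm]; last first.
  rewrite addr0; suff -> : all (fun i => i < B.+1)%N m = all (fun i => i < B)%N m by [].
  apply: eq_in_all => i im; rewrite ltnS leq_eqVlt; case: eqP => // iB.
  by case/negP: nBm; rewrite -iB.
have mm := mset_cons Bm; rewrite !(perm_all _ mm) (perm_size mm) (perm_uniq mm) /=.
rewrite ltnn leqnn /= add0r eqSS; set s := enum_mset _.
(* [s] is [m] without one copy of [B]: it is below [B] exactly when it is below [B.+1] and no second
   copy is left. *)
have -> : all (fun i => i < B)%N s = all (fun i => i < B.+1)%N s && (B \notin s).
  apply/allP/andP => [sB|[/allP sB Bs] i si].
    split; first by apply/allP => i /sB /ltnW.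
    by apply/negP => /sB; rewrite ltnn.
  move: (sB i si); rewrite ltnS leq_eqVlt => /predU1P[iB|//].
  by rewrite -iB si in Bs.
by case: (all _ _); case: (B \in s); rewrite ?andbF.
Qed.

Lemma truncate_esym_part B la :
  truncate B (esym_part R la) = \prod_(k <- la) elem fpsX B k.
Proof. by rewrite truncate_prod; apply: eq_bigr => k _; exact: truncate_esym. Qed.

End Fps.

(** The colorings whose monomial is below [B.+1] are those with colors in ['I_B.+1], finitely
    many. *)
Lemma truncate_XB n B (H : mgraph n.+1) :
  truncate B.+1 (XB H) = \sum_(kappa : {ffun 'I_n.+1 -> 'I_B.+1})
    ((1 + 'X) ^+ num_mono H (nat_coloring kappa) : {poly int}) *:
      \prod_v fpsX _ (kappa v).
Proof.
apply: fpsE => m; rewrite fps_sumE.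
pose mon (kappa : {ffun 'I_n.+1 -> nat}) := seq_mset [seq kappa v | v <- enum 'I_n.+1].
transitivity (\sum_(kappa : {ffun 'I_n.+1 -> 'I_B.+1} | mon (nat_coloring kappa) == m)
   (1 + 'X : {poly int}) ^+ num_mono H (nat_coloring kappa)); last first.
  rewrite big_mkcond; apply: eq_bigr => kappa _.
  set c := _ ^+ _; rewrite -[RHS]/(c * (\prod_v fpsX _ (kappa v)) m).
  have -> : \prod_v fpsX {poly int} (kappa v) = monomial _ (mon (nat_coloring kappa)).
    rewrite -prod_fpsX big_map big_enum; apply: eq_bigr => v _.
    by rewrite ffunE.
  by rewrite /monomial eq_sym; case: ifP; rewrite ?mulr1 ?mulr0.
rewrite /truncate; case: (boolP (below B.+1 m)) => [mB|nmB]; last first.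
  rewrite big1// => kappa /eqP km; case/negP: nmB; apply/belowP => i.
  rewrite -km -[i \in _]/(i \in enum_mset _) (perm_mem (perm_eq_seq_mset _)).
  by case/mapP => v _ ->; rewrite ffunE ltn_ord.
rewrite /XB /fps_sum.
rewrite (fsbigE [seq nat_coloring kappa | kappa : {ffun 'I_n.+1 -> 'I_B.+1} <-
   enum {ffun 'I_n.+1 -> 'I_B.+1} & mon (nat_coloring kappa) == m]).
- rewrite big_map big_filter_cond big_enum_cond; apply: eq_bigl => kappa /=.
  by apply: andb_idr => /eqP km; rewrite mem_set.
- rewrite map_inj_uniq => [|k1 k2 /ffunP k12]; first exact/filter_uniq/enum_uniq.
  by apply/ffunP => v; have := k12 v; rewrite !ffunE => /val_inj.
- by move=> kappa /= /mapP[k + ->]; rewrite mem_filter => /andP[/eqP].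
move=> kappa /= km /mapP[].
have kB v : (kappa v < B.+1)%N.
  apply: (belowP _ _ mB); rewrite -km -[_ \in _]/(_ \in enum_mset _).
  by rewrite (perm_mem (perm_eq_seq_mset _)) map_f ?mem_enum.
pose k : {ffun 'I_n.+1 -> 'I_B.+1} := [ffun v => Ordinal (kB v)].
have kE : kappa = nat_coloring k by apply/ffunP => v; rewrite !ffunE.
by exists k => //; rewrite mem_filter mem_enum -kE /mon km eqxx.
Qed.

Lemma truncate_tutte_matrix n (G : sgraph n.+1) B q :
  truncate B (tutte_matrix G q.+1 q.+1) =
  \sum_(S in STi G q.+1 q.+1)
     (-1) ^+ ((n + q).+1 - size (st_type S)) * (-1) ^+ q *
     fpsC 'X ^+ (st_edges S + 1 - q.+1) *
     \prod_(i <- reduced_type S) elem (fpsX {poly int}) B i.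
Proof.
rewrite truncate_sum; apply: eq_bigr => S _; rewrite truncateZ truncate_esym_part fps_scaleE.
by rewrite !fpsCM !fpsCX /= fpsCN fpsC1.
Qed.

(** Every truncation is [sum_colorings] in the ring of series, with the series [fpsX] as variables
    and the constant series [fpsC 'X] as [t]. *)
Lemma XB_glue_sum n (G : sgraph n.+2) :
  XB (glue G) = \sum_(q < n.+1) tutte_matrix G q.+1 q.+1.
Proof.
apply: truncate_eq => B; rewrite truncate_XB truncate_sum.
under [RHS]eq_bigr do rewrite truncate_tutte_matrix.
rewrite -sum_colorings; apply: eq_bigr => kappa _.
by rewrite fps_scaleE fpsCX fpsCD fpsC1.
Qed.

(** The sum has [n + q + 2] vertices, fewer than [2 (q + 1)]. That many are needed: by the head
    [q.+1] and the path if the two components differ, by the first and last parts of the composition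
    if they coincide. *)
Lemma STi_eq0 n (G : sgraph n.+2) q : (n < q)%N -> STi G q.+1 q.+1 = finset.set0.
Proof.
move=> lt_nq; apply/setP => S; rewrite finset.in_set0 STiE.
apply/negP => /andP[SH /forall_inP Sok].
have [c cS c0] := ST_cover SH ord0; have [d dS dn] := ST_cover SH (inord n.+1).
have /andP[/implyP/(_ c0)/andP[/eqP hc _] _] := Sok c cS.
have /andP[_ /implyP/(_ dn)/andP[pd ld]] := Sok d dS.
have cc := calpha_composition SH cS.
pose path : {set 'I_(n.+1 + q).+1} := [set v : 'I_(n.+1 + q).+1 | (n < v)%N].
have card_path : #|path| = q.+1.
  transitivity #|@collapse n.+1 q @^-1: [set ord_max]|.
    by apply: eq_card => v; rewrite !inE -val_eqE /= val_collapse; lia.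
  by rewrite card_collapse_preimset cards1 set11.
have [al calE] : exists al, calpha c = q.+1 :: al.
  by case: (calpha c) hc => //= h al ->; exists al.
have lt_qc : (q < #|cverts c|)%N.
  by apply: composition_part cc _; rewrite calE mem_head.
have le_cV : (#|cverts c| <= (n.+1 + q).+1)%N by rewrite -[X in (_ <= X)%N]card_ord max_card.
have [cd|cd] := eqVneq c d.
  rewrite -{}cd calE /= in pd ld.
  (* The path and [ord0] already exceed the head [q.+1], so there is a second part and the last one
     is counted in addition to the head. *)
  have : (#|ord0 |: path| <= #|cverts c|)%N.
    by apply/subset_leq_card/fintype.subsetP => v /setU1P[->//|]; exact: (fintype.subsetP pd).
  rewrite cardsU1 card_path inE /=.
  move: cc; rewrite calE composition_cons => /and3P[_ _ cal].
  case: al ld cal {calE} => [_ /andP[_ /eqP]|i al /= ld cal]; first by rewrite /=; lia.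
  have le_last := composition_part cal (mem_last i al) => _.
  have : (q < #|cverts c| - q.+1)%N := leq_trans ld le_last.
  by rewrite ltn_subRL ltnNge => /negP; apply; apply: leq_trans le_cV _; lia.
have : (#|path| + #|cverts c| <= (n.+1 + q).+1)%N; last by lia.
rewrite -[X in (_ <= X)%N]card_ord; apply: leq_trans (max_card (path :|: cverts c)).
rewrite cardsU (_ : path :&: cverts c = finset.set0) ?cards0 ?subn0//.
apply/setP => v; rewrite finset.in_set0; apply/negP => /setIP[vp vc].
by case/eqP: cd; apply: (ST_eq SH cS dS vc); exact: (fintype.subsetP pd).
Qed.

Lemma tutte_matrix_diag_eq0 n (G : sgraph n.+2) k : (n.+2 <= k)%N -> tutte_matrix G k k = 0.
Proof.
by case: k => // q lt_nq; rewrite /tutte_matrix STi_eq0// big_set0.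
Qed.

Theorem theorem4p2 (n : nat) (G : sgraph n.+2) :
  XB (glue G) = trace (tutte_matrix G) /\
  trace (tutte_matrix G) = \sum_(1 <= k < n.+2) tutte_matrix G k k.
Proof.
suff traceE : trace (tutte_matrix G) = \sum_(1 <= k < n.+2) tutte_matrix G k k.
  by rewrite traceE XB_glue_sum big_add1 big_mkord.
(* The entries from index [n.+2] on vanish, so the infinite trace has finite support. *)
rewrite /trace (fsbigE (index_iota 1 n.+2)) ?iota_uniq//.
- rewrite big_mkcond big_nat [RHS]big_nat; apply: eq_bigr => k /andP[k0 _].
  by rewrite mem_set.
- by move=> k; rewrite /= mem_index_iota => /andP[].
move=> k /= k0; rewrite mem_index_iota k0 /= -leqNgt; exact: tutte_matrix_diag_eq0.
Qed.
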